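(* Let $Z=(Z_1,\dots,Z_n)$ be a vector of mutually independent random variables taking values in a Polish space $\mathcal{Z}$, let $\boldsymbol{H}:\mathcal{Z}\to\mathbb{H}^d$ be a measurable function, let $\boldsymbol{X}=\boldsymbol{H}(Z)-\mathbb{E}\,\boldsymbol{H}(Z)$, and let $\boldsymbol{V}$ be the variance proxy defined in the context. Assume that $\|\boldsymbol{X}\|$ is bounded. Then for all $\psi>0$ and all real $\theta$ with $|\theta|<\sqrt{\psi/2}$, $$\log\mathbb{E}\,\bar{\operatorname{tr}}\,e^{\theta\boldsymbol{X}}\le\frac{\theta^2/\psi}{1-2\theta^2/\psi}\,\log\mathbb{E}\,\bar{\operatorname{tr}}\,e^{\psi\boldsymbol{V}}.$$
   Context: $\mathbb{H}^d$ is the real-linear space of $d\times d$ complex Hermitian matrices; $\|\cdot\|$ is the spectral (operator) norm; $\bar{\operatorname{tr}}\,\boldsymbol{B}=\frac1d\operatorname{tr}\boldsymbol{B}$ is the normalized trace of a $d\times d$ matrix; $e^{\boldsymbol{A}}$ is the matrix exponential. Setup: $Z=(Z_1,\dots,Z_n)\in\mathcal{Z}$, where $\mathcal{Z}$ is the (Polish) space of $n$-tuples in which $Z$ takes its values. For each $j$, put $Z^{(j)}=(Z_1,\dots,Z_{j-1},\widetilde{Z}_j,Z_{j+1},\dots,Z_n)$, where $\widetilde{Z}_j$ is an independent copy of $Z_j$ (independent of $Z$). Put $\boldsymbol{X}^{(j)}=\boldsymbol{H}(Z^{(j)})-\mathbb{E}\,\boldsymbol{H}(Z)$. The variance proxy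 is the random matrix $$\boldsymbol{V}=\frac12\sum_{j=1}^n\mathbb{E}\big[(\boldsymbol{X}-\boldsymbol{X}^{(j)})^2\,\big|\,Z\big].$$ *)

(* Defs.v *)
From HB Require Import structures.
From mathcomp Require Import all_boot all_order all_algebra.
From mathcomp Require Import all_classical all_reals all_analysis.
From mathcomp Require Import complex.

Set Implicit Arguments.
Unset Strict Implicit.
Unset Printing Implicit Defensive.

Import Order.TTheory GRing.Theory Num.Theory.
Import numFieldNormedType.Exports.

Local Open Scope classical_set_scope.
Local Open Scope ring_scope.
Local Open Scope complex_scope.

HB.instance Definition _ (I : Type) (T : I -> ptopologicalType) :=
  Pointed.copy (prod_topology T) (forall i : I, T i).

Definition polish (R : realType) (T : topologicalType) : Prop :=
  (exists D : set T, countable D /\ dense D) /\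
  exists dist : T -> T -> R,
    [/\ (forall x y, 0 <= dist x y) /\ (forall x y, dist x y = 0 <-> x = y),
        forall x y, dist x y = dist y x,
        forall x y z, dist x z <= dist x y + dist y z,
        forall (x : T) (A : set T), nbhs x A <->
          exists2 e, 0 < e & [set y | dist x y < e] `<=` A
      & forall u : nat -> T,
          (forall e, 0 < e -> exists N : nat, forall p q : nat,
             (N <= p)%N -> (N <= q)%N -> dist (u p) (u q) < e) ->
          exists l : T, u @ \oo --> l].

Notation borelType T := (g_sigma_algebraType (@open T)).

(* Stated over an abstract numFieldType because [R[i]] has no declared topology
   of its own; limits in ['M[C]_d] are entrywise limits in [C]. *)
Definition expmx (C : numFieldType) (d : nat) (A : 'M[C]_d) : 'M[C]_d :=
  limn (series (fun k : nat => (k`!%:R)^-1 *: A ^+ k)).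

Section matrices.
Context {R : realType} {d : nat}.
Implicit Types A : 'M[R[i]]_d.

Definition vnorm (x : 'cV[R[i]]_d) : R :=
  Num.sqrt (\sum_(i < d)
    ((complex.Re (x i 0)) ^+ 2 + (complex.Im (x i 0)) ^+ 2)).

Definition opnorm A : R :=
  sup [set vnorm (A *m x) | x in [set x | vnorm x <= 1]].

Definition ntrace A : R[i] := (d%:R)^-1 * \tr A.

End matrices.

Section random_matrices.
Context {R : realType} {d : nat}.

Definition measurable_mx (dT : measure_display) (T : measurableType dT)
    (F : T -> 'M[R[i]]_d) : Prop :=
  forall i j, measurable_fun setT (fun t => complex.Re (F t i j)) /\
              measurable_fun setT (fun t => complex.Im (F t i j)).

Context {dO : measure_display} {Omega : measurableType dO}.
Variable P : probability Omega R.

Definition expectation_mx (Y : Omega -> 'M[R[i]]_d) : 'M[R[i]]_d :=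
  \matrix_(i, j) (fine 'E_P[fun w => complex.Re (Y w i j)] +i*
                  fine 'E_P[fun w => complex.Im (Y w i j)]).

(* [W] is a version of the conditional expectation of [Y] given the
   sub-sigma-algebra [G] *)
Definition is_cond_expectation (G : set (set Omega)) (Y W : Omega -> R) : Prop :=
  [/\ forall B : set R, measurable B -> G (W @^-1` B),
      P.-integrable setT (EFin \o W)
    & forall A, G A ->
        (\int[P]_(w in A) (W w)%:E = \int[P]_(w in A) (Y w)%:E)%E].

Definition is_cond_expectation_mx (G : set (set Omega))
    (Y W : Omega -> 'M[R[i]]_d) : Prop :=
  forall i j,
    is_cond_expectation G (fun w => complex.Re (Y w i j))
                          (fun w => complex.Re (W w i j)) /\
    is_cond_expectation G (fun w => complex.Im (Y w i j))
                          (fun w => complex.Im (W w i j)).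

End random_matrices.

Section independence.
Context {R : realType} {dO : measure_display} {Omega : measurableType dO}.
Variable P : probability Omega R.

(* Subfamilies are covered by taking [A j = setT] outside of them. *)
Definition mutually_independent (n : nat) (T : 'I_n -> ptopologicalType)
    (Z : forall j, Omega -> borelType (T j)) : Prop :=
  forall A : (forall j, set (borelType (T j))),
    (forall j, measurable (A j)) ->
    P (\bigcap_j (Z j @^-1` A j)) =
    (\prod_(j < n) P (Z j @^-1` A j))%E.

Definition independent (d1 d2 : measure_display)
    (T1 : measurableType d1) (T2 : measurableType d2)
    (X : Omega -> T1) (Y : Omega -> T2) : Prop :=
  forall A B, measurable A -> measurable B ->
    P (X @^-1` A `&` Y @^-1` B) = (P (X @^-1` A) * P (Y @^-1` B))%E.

Definition same_distribution (d1 : measure_display) (T1 : measurableType d1)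
    (X Y : Omega -> T1) : Prop :=
  forall A, measurable A -> P (X @^-1` A) = P (Y @^-1` A).

End independence.

Section efron_stein.
Context {R : realType} {dO : measure_display} {Omega : measurableType dO}.
Variable P : probability Omega R.
Context {n d : nat} {T : 'I_n -> ptopologicalType}.
Variables (Z : Omega -> borelType (prod_topology T))
          (Z' : forall j, Omega -> borelType (T j))
          (H : borelType (prod_topology T) -> 'M[R[i]]_d).

(* For every [j], [Z' j] is an independent copy of [Z_j]; nothing is assumed
   about the joint law of [Z'_1, ..., Z'_n]. *)
Definition independent_copies : Prop :=
  forall j, [/\ measurable_fun setT (Z' j),
                same_distribution P (Z' j) (fun w => Z w j : borelType (T j))
              & independent P (Z' j) Z].

Definition replace_coord (j : 'I_n) (w : Omega) : borelType (prod_topology T) :=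
  @dfwith _ T (Z w) j (Z' j w).

Definition centered (w : Omega) : 'M[R[i]]_d :=
  H (Z w) - expectation_mx P (H \o Z).

Definition centered_copy (j : 'I_n) (w : Omega) : 'M[R[i]]_d :=
  H (replace_coord j w) - expectation_mx P (H \o Z).

(* Conditional expectations being defined up to null sets, so is the variance
   proxy: [V] is one of its versions. *)
Definition is_variance_proxy (V : Omega -> 'M[R[i]]_d) : Prop :=
  exists W : 'I_n -> Omega -> 'M[R[i]]_d,
    (forall j, is_cond_expectation_mx P (g_sigma_algebra_preimage Z)
       (fun w => (centered w - centered_copy j w) ^+ 2) (W j)) /\
    forall w, V w = 2^-1 *: \sum_(j < n) W j w.

End efron_stein.

(* Main.v *)
(** Write [G = H - E H], [V] for the variance proxy as a function of [z], and
    [g(t) = E tr (G e^(tG))] for the derivative of [m(t) = E tr e^(tG)].  For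
    independent copies [z, w] of the vector and a permutation [s] of the
    coordinates, [G(z) - G(w)] telescopes along the hybrids that use [z] on the
    first [k] coordinates in the order [s] and [w] elsewhere.  Exchanging [z_j]
    and [w_j] turns the increment [C] into an expression
    [tr C (e^A - e^B)], bounded by
    [1/4 tr ((s (A - B)^2 + C^2 / s) (e^A + e^B))].
    Averaging over all permutations, with a weight depending on [k], replaces
    the increments by full sums over the coordinates and gives [g(t) <= 2 t K]
    as soon as [K] bounds [E tr (e^(tG(z)) V(x))] for every hybrid [x] of [z]
    and [w].  By Klein's inequality (the Gibbs variational principle)
    [K = (t g(t) + L m(t)) / psi] is such a bound, where [L] is the logarithm of
    the normalized trace moment of [e^(psi V)].  Solving for [g = m'] and
    integrating [(ln m)'] from [0] to [theta] yields the theorem. *)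

Require Import Defs.
From HB Require Import structures.
From mathcomp Require Import all_boot all_order all_algebra.
From mathcomp Require Import all_classical all_reals all_analysis.
From mathcomp Require Import fingroup perm measurable_realfun complex spectral ring lra.

Set Implicit Arguments.
Unset Strict Implicit.
Unset Printing Implicit Defensive.

Import Order.TTheory GRing.Theory Num.Theory.
Import numFieldNormedType.Exports.

Local Open Scope classical_set_scope.
Local Open Scope ring_scope.
Local Open Scope complex_scope.
Local Open Scope sesquilinear_scope.

(** One fixed order of the coordinates is not enough: along a single chain every increment lives at
    a different hybrid, and squares taken at different hybrids do not add up to the proxy at one
    point. In a random order, given the set of the first [k+1] coordinates, the last of them is
    uniform in that set. So the full sum over the set appears, divided by [k+1], whereas the squared
    jumps at [z] are divided by [n]. The weight [s = sqrt (n / (k+1)) / t] balances the two; each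
    position then costs [t K / sqrt (n (k+1))], and these costs add up to at most [2 t K]. This is
    the 2 in [1 - 2 theta^2 / psi].

    The other obstacle is regularity. [X] is bounded only almost surely and [V] is an arbitrary
    version of a conditional expectation, so the analysis is done on the law of [Z], with [H]
    truncated to be bounded everywhere, and is carried back through almost sure equalities.
    Differentiation under the expectation is avoided: convexity of the trace exponential gives chord
    bounds, which are summed over a fine partition. *)

(** * Spectral calculus, and traces expanded over two eigenbases *)

Section spectral.
Context {C : numClosedFieldType} {d : nat}.
Implicit Types (U W X Y A B : 'M[C]_d) (f g : 'I_d -> C).

(** A function of a Hermitian matrix changes only [f], so the pair [U], [f] is kept explicit. The
    eigenvectors are the columns of [U^t*]. *)
Definition specmx U f : 'M[C]_d := U^t* *m diag_mx (\row_i f i) *m U.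

Lemma hermsymmxP A : reflect (A^t* = A) (A \is hermsymmx).
Proof.
by apply: (iffP (is_hermitianmxP _ _ _)); rewrite expr0 scale1r => /esym.
Qed.

Lemma unitarymxK U : U \is unitarymx -> U^t* *m U = 1%:M.
Proof. by move=> /unitarymxP /mulmx1C. Qed.

Lemma herm_specmx A : A \is hermsymmx ->
  exists U f, [/\ U \is unitarymx, forall i, f i \is Num.real & A = specmx U f].
Proof.
move=> hA; have /hermitian_normalmx/orthomx_spectralP AE := hA.
exists (spectralmx A), (spectral_diag A 0); split.
- exact: spectral_unitarymx.
- by move=> i; have /mxOverP := hermitian_spectral_diag_real hA; apply.
rewrite {1}AE invmx_unitary ?spectral_unitarymx// /specmx.
by congr (_ *m diag_mx _ *m _); apply/rowP => i; rewrite !mxE.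
Qed.

Lemma specmxZ U f t : t *: specmx U f = specmx U (fun i => t * f i).
Proof.
rewrite /specmx scalemxAl scalemxAr; congr (_ *m _ *m _).
by apply/matrixP => i j; rewrite !mxE mulrnAr.
Qed.

Lemma specmxM U f g : U \is unitarymx ->
  specmx U f *m specmx U g = specmx U (fun i => f i * g i).
Proof.
move=> /unitarymxP uU; rewrite /specmx !mulmxA -(mulmxA _ U) uU mulmx1.
rewrite -(mulmxA _ (diag_mx _) (diag_mx _)) mulmx_diag.
by congr (_ *m diag_mx _ *m _); apply/rowP => i; rewrite !mxE.
Qed.

Lemma specmx1 U : U \is unitarymx -> specmx U (fun=> 1) = 1%:M.
Proof.
move=> uU; rewrite /specmx (_ : diag_mx _ = 1%:M) ?mulmx1.
  by rewrite unitarymxK.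
by apply/matrixP => i j; rewrite !mxE.
Qed.

Lemma specmxX U f k : U \is unitarymx ->
  specmx U f ^+ k = specmx U (fun i => f i ^+ k).
Proof.
move=> uU; elim: k => [|k IH]; first exact/esym/specmx1.
rewrite exprS IH -[_ * _]/(_ *m _) specmxM//.
by congr specmx; apply/funext => i; rewrite exprS.
Qed.

Lemma specmxE U f i j :
  specmx U f i j = \sum_k (U k i)^*%R * f k * U k j.
Proof.
rewrite /specmx mxE; apply: eq_bigr => k _; congr (_ * _).
by rewrite mul_mx_diag !mxE.
Qed.

(** Inserting [W^t* *m W] between [X] and [Y] turns the trace into a sum over pairs of eigenvectors,
    one from each of two bases. Inequalities between noncommuting matrices thereby reduce to scalar
    ones, one for each pair of eigenvalues. *)
Lemma mxtrace_specmxM U W f X Y : W \is unitarymx ->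
  \tr (specmx U f *m (X *m Y)) =
  \sum_i \sum_j f i * ((U *m X *m W^t*) i j * (W *m Y *m U^t*) j i).
Proof.
move=> uW; have uW' := unitarymxK uW.
rewrite /specmx -!mulmxA mxtrace_mulC -!mulmxA.
have -> : U *m (X *m (Y *m U^t*)) = (U *m X *m W^t*) *m (W *m Y *m U^t*).
  by rewrite !mulmxA -(mulmxA _ _ W) uW' mulmx1.
rewrite /mxtrace; apply: eq_bigr => i _.
by rewrite mul_diag_mx mxE [X in X * _]mxE [X in _ * X]mxE big_distrr/= !mulmxA.
Qed.

Lemma hermsymmx_adjE U W X i j : X \is hermsymmx ->
  (W *m X *m U^t*) j i = ((U *m X *m W^t*) i j)^*%R.
Proof.
move=> /hermsymmxP hX.
have -> : ((U *m X *m W^t*) i j)^*%R = ((U *m X *m W^t*)^t*) j i.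
  by rewrite [RHS]mxE [X in _ = Num.conj X]mxE.
by rewrite !trmx_mul !map_mxM trmxCK hX mulmxA.
Qed.

Lemma mxtrace_specmxMl U W f X Y : W \is unitarymx -> Y \is hermsymmx ->
  \tr (specmx U f *m (X *m Y)) =
  \sum_i \sum_j f i * ((U *m X *m W^t*) i j * ((U *m Y *m W^t*) i j)^*%R).
Proof.
move=> uW hY; rewrite (mxtrace_specmxM _ _ _ _ uW).
apply: eq_bigr => i _; apply: eq_bigr => j _.
by rewrite (hermsymmx_adjE U W i j hY).
Qed.

Lemma mxtrace_specmxMr U W f X Y : U \is unitarymx -> X \is hermsymmx ->
  \tr (specmx W f *m (X *m Y)) =
  \sum_i \sum_j f j * (((U *m X *m W^t*) i j)^*%R * (U *m Y *m W^t*) i j).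
Proof.
move=> uU hX; rewrite (mxtrace_specmxM _ _ _ _ uU) exchange_big/=.
apply: eq_bigr => i _; apply: eq_bigr => j _.
by rewrite (hermsymmx_adjE U W i j hX).
Qed.

Lemma conj_specmxl U W f i j : U \is unitarymx ->
  (U *m specmx U f *m W^t*) i j = f i * (U *m 1%:M *m W^t*) i j.
Proof.
move=> /unitarymxP uU; rewrite mulmx1 /specmx !mulmxA uU mul1mx -mulmxA.
by rewrite mul_diag_mx mxE [X in X * _]mxE.
Qed.

Lemma conj_specmxr U W f i j : W \is unitarymx ->
  (U *m specmx W f *m W^t*) i j = f j * (U *m 1%:M *m W^t*) i j.
Proof.
move=> /unitarymxP uW; rewrite mulmx1 /specmx -!mulmxA uW mulmx1 mulmxA.
by rewrite mul_mx_diag mxE [X in _ * X]mxE mulrC.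
Qed.

(** In the mixed basis the difference of two noncommuting matrices merely scales the entries of
    [U *m W^t*] by differences of eigenvalues. The factor [1%:M] is kept so that the result matches
    the trace expansions with [X] or [Y] equal to the identity. *)
Lemma conj_specmxB U W f g i j : U \is unitarymx -> W \is unitarymx ->
  (U *m (specmx U f - specmx W g) *m W^t*) i j =
  (f i - g j) * (U *m 1%:M *m W^t*) i j.
Proof.
move=> uU uW; rewrite mulmxBr mulmxBl mxE [X in _ + X]mxE.
by rewrite (conj_specmxl _ _ _ _ uU) (conj_specmxr _ _ _ _ uW) mulrBl.
Qed.

Lemma mxtrace_specmx U f : U \is unitarymx -> \tr (specmx U f) = \sum_i f i.
Proof.
move=> uU; rewrite /specmx mxtrace_mulC mulmxA (elimT unitarymxP uU) mul1mx.
by rewrite mxtrace_diag; apply: eq_bigr => i _; rewrite mxE.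
Qed.

Lemma unitarymx_entry_le1 U i j : U \is unitarymx -> `|U i j| <= 1.
Proof.
move=> /unitarymxP/matrixP/(_ i i); rewrite !mxE eqxx => UE.
rewrite -(@expr_le1 _ 2)// -[leRHS]UE (bigD1 j)//= !mxE normCK lerDl.
by rewrite sumr_ge0// => k _; rewrite !mxE -normCK exprn_ge0.
Qed.

End spectral.

(** * The exponential of a Hermitian matrix through its eigenvalues *)

Section exponential_series.
Context {C : numClosedFieldType} {d : nat}.
Implicit Types (U : 'M[C]_d) (f g : 'I_d -> C).

Lemma cvg_mx_entries (u : nat -> 'M[C]_d) (l : 'M[C]_d) :
  (forall i j, u n i j @[n --> \oo] --> l i j) -> u n @[n --> \oo] --> l.
Proof.
move=> ul; apply/cvg_ballP => e e0.
have : \forall n \near \oo, forall i, (fun i n => forall j, ball (l i j) e (u n i j)) i n.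
  apply: filter_forall => i; apply: filter_forall => j.
  exact: (cvg_ball (ul i j)).
by apply: filterS => n ule; split.
Qed.

Lemma series_specmxE U f i j n : U \is unitarymx ->
  series (fun k : nat => (k`!%:R)^-1 *: specmx U f ^+ k) n i j =
  \sum_l (U l i)^*%R * series (fun k : nat => (k`!%:R)^-1 * f l ^+ k) n * U l j.
Proof.
move=> uU; rewrite /series/= summxE.
transitivity (\sum_(0 <= k < n) \sum_l (U l i)^*%R * ((k`!%:R)^-1 * f l ^+ k) * U l j).
  apply: eq_bigr => k _.
  have := congr1 (fun M : 'M[C]_d => ((k`!%:R)^-1 *: M) i j) (specmxX f k uU).
  by rewrite specmxZ specmxE => <-.
rewrite exchange_big/=; apply: eq_bigr => l _.
by rewrite big_distrr/= big_distrl.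
Qed.

Lemma cvg_series_specmx U f g : U \is unitarymx ->
  (forall i, series (fun k : nat => (k`!%:R)^-1 * f i ^+ k) n @[n --> \oo] --> g i) ->
  forall i j, series (fun k : nat => (k`!%:R)^-1 *: specmx U f ^+ k) n i j @[n --> \oo]
    --> specmx U g i j.
Proof.
move=> uU fg i j; rewrite specmxE.
under eq_fun do rewrite series_specmxE//.
apply: cvg_big => [x|l _]; first exact: add_continuous.
 apply: cvgM; last exact: cvg_cst.
by apply: cvgM; [exact: cvg_cst|exact: fg].
Qed.

Lemma expmx_specmx_cvg U f g : U \is unitarymx ->
  (forall i, series (fun k : nat => (k`!%:R)^-1 * f i ^+ k) n @[n --> \oo] --> g i) ->
  expmx (specmx U f) = specmx U g.
Proof.
move=> uU fg; rewrite /expmx; apply/cvg_lim => //.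
by apply: cvg_mx_entries; exact: cvg_series_specmx.
Qed.

End exponential_series.

Section complex_limits.
Context {R : realType}.
(* [R[i]] only gets its topology when seen as a [numFieldType]. *)
Local Notation C := (Num.NumField.sort (R[i] : numFieldType)).

Lemma cvg_real_complex (u : nat -> R) (l : R) :
  u n @[n --> \oo] --> l -> ((u n)%:C : C) @[n --> \oo] --> (l%:C : C).
Proof.
move=> ul; apply/cvgrPdist_lt => e e0.
have eE : e = (complex.Re e)%:C by rewrite RRe_real// gtr0_real.
have e0' : 0 < complex.Re e by rewrite -ltcR -eE.
move/cvgrPdist_lt : ul => /(_ _ e0'); apply: filterS => n.
by rewrite -rmorphB /= normc_def/= expr0n/= addr0 sqrtr_sqr {2}eE ltcR.
Qed.

Lemma cvg_complex_Re (u : nat -> C) (l : C) :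
  u n @[n --> \oo] --> l -> complex.Re (u n) @[n --> \oo] --> complex.Re l.
Proof.
move=> ul; apply/cvgrPdist_lt => e e0.
have e0' : 0 < e%:C :> R[i] by rewrite ltcR.
move/cvgrPdist_lt : ul => /(_ _ e0'); apply: filterS => n.
rewrite -raddfB -ltcR; apply: le_lt_trans; exact: normc_ge_Re.
Qed.

Lemma cvg_complex_Im (u : nat -> C) (l : C) :
  u n @[n --> \oo] --> l -> complex.Im (u n) @[n --> \oo] --> complex.Im l.
Proof.
move=> ul; apply/cvgrPdist_lt => e e0.
have e0' : 0 < e%:C :> R[i] by rewrite ltcR.
move/cvgrPdist_lt : ul => /(_ _ e0'); apply: filterS => n.
rewrite -raddfB -ltcR; apply: le_lt_trans.
by rewrite normc_def lecR -sqrtr_sqr ler_wsqrtr// lerDr sqr_ge0.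
Qed.

Lemma cvg_series_expRC (x : R) :
  series (fun k : nat => (k`!%:R)^-1 * (x%:C : C) ^+ k) n @[n --> \oo] -->
    ((expR x)%:C : C).
Proof.
have := is_cvg_series_exp_coeff x => /cvg_real_complex.
rewrite -/(expR x); apply: cvg_trans; apply: near_eq_cvg; near=> n.
rewrite /series/= rmorph_sum; apply: eq_bigr => k _.
by rewrite /exp_coeff/= mulrC rmorphM rmorphXn fmorphV rmorph_nat.
Unshelve. all: by end_near. Qed.

End complex_limits.

Section hermitian_exponential.
Context {R : realType} {d : nat}.
Implicit Types (U A B : 'M[R[i]]_d) (a b : 'I_d -> R).

Lemma expmx_specmx U a : U \is unitarymx ->
  expmx (specmx U (fun i => (a i)%:C)) = specmx U (fun i => (expR (a i))%:C).
Proof. by move=> uU; apply: expmx_specmx_cvg => // i; exact: cvg_series_expRC. Qed.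

Lemma hermsymmx_spectral A : A \is hermsymmx ->
  exists U a, [/\ U \is unitarymx, A = specmx U (fun i => (a i)%:C) &
    expmx A = specmx U (fun i => (expR (a i))%:C)].
Proof.
move=> /herm_specmx[U [f [uU fr AE]]]; exists U, (fun i => complex.Re (f i)).
have fE : f = (fun i => (complex.Re (f i))%:C).
  by apply/funext => i; rewrite RRe_real.
have {}AE : A = specmx U (fun i => (complex.Re (f i))%:C) by rewrite -fE.
by split; [exact: uU|exact: AE|rewrite AE; exact: expmx_specmx].
Qed.

Lemma cvg_series_hermsymmx A i j : A \is hermsymmx ->
  series (fun k : nat => (k`!%:R)^-1 *: A ^+ k) n i j @[n --> \oo] --> expmx A i j.
Proof.
move=> /hermsymmx_spectral[U [a [uU AE ->]]]; rewrite AE.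
by apply: cvg_series_specmx => // k; exact: cvg_series_expRC.
Qed.

End hermitian_exponential.

(** * Scalar inequalities for the exponential *)

Section scalar_exponential.
Context {R : realType}.
Implicit Types a b x : R.

(** This is [2 tanh (x/2) <= x]. The difference of the two sides vanishes at 0 and has derivative
    [1 + (y - 1) e^y], which is nonnegative because [e^(-y) >= 1 - y]. *)
Lemma expR_sub1_le x : 0 <= x -> 2 * (expR x - 1) <= x * (expR x + 1).
Proof.
move=> x0; rewrite -subr_ge0.
pose f (y : R) := y * (expR y + 1) - 2 * (expR y - 1).
have df (y : R) : is_derive y 1 f (1 + (y - 1) * expR y).
  rewrite /f; apply: is_derive_eq. rewrite /GRing.scale/=; ring.
have -> : 0 = f 0 by rewrite /f expR0; ring.
apply: (@ger0_derive1_ndecry _ f 0) => //.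
- move=> y _; rewrite derive1E derive_val.
  have ey := expR_gt0 y; have := expR_ge1Dx (- y).
  rewrite -(ler_pM2r ey) -expRD addNr expR0; lra.
- apply: continuous_subspaceT => y; apply/differentiable_continuous/derivable1_diffP.
  by have [] := df y.
Qed.

(** The logarithmic mean of [e^a] and [e^b] is at most their arithmetic mean. *)
Lemma expR_dist_le a b :
  2 * `|expR a - expR b| <= `|a - b| * (expR a + expR b).
Proof.
wlog ab : a b / b <= a => [h|].
  case: (leP b a) => [|/ltW] ab; first exact: h.
  by rewrite distrC (distrC a) (addrC (expR a)); exact: h.
rewrite !ger0_norm ?subr_ge0 ?ler_expR//.
have := @expR_sub1_le (a - b); rewrite subr_ge0 => /(_ ab).
have -> : expR a = expR (a - b) * expR b by rewrite -expRD subrK.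
have := expR_gt0 b; nra.
Qed.

Lemma expR_klein a b : expR a * (b - a) <= expR b - expR a.
Proof.
have -> : expR b = expR (b - a) * expR a by rewrite -expRD subrK.
have := expR_ge1Dx (b - a); have := expR_gt0 a; nra.
Qed.

End scalar_exponential.

(** * Trace inequalities for Hermitian matrices *)

Section trace_inequalities.
Context {R : realType} {d : nat}.
Implicit Types (U W X Y A B : 'M[R[i]]_d) (f g : 'I_d -> R).

(** The real part allows inequalities in [R] between traces of products, without first showing that
    these traces are real. *)
Definition rtr A : R := complex.Re (\tr A).

Lemma rtrD A B : rtr (A + B) = rtr A + rtr B.
Proof. by rewrite /rtr mxtraceD raddfD. Qed.

Lemma rtrB A B : rtr (A - B) = rtr A - rtr B.
Proof. by rewrite /rtr raddfB raddfB. Qed.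

Lemma rtrZ (t : R) A : rtr (t%:C *: A) = t * rtr A.
Proof. by rewrite /rtr mxtraceZ; case: (\tr A) => a b /=; rewrite mul0r subr0. Qed.

Lemma rtr_sum I (s : seq I) (F : I -> 'M[R[i]]_d) :
  rtr (\sum_(i <- s) F i) = \sum_(i <- s) rtr (F i).
Proof.
elim: s => [|i s IH]; last by rewrite !big_cons rtrD IH.
by rewrite !big_nil /rtr mxtrace0.
Qed.

Definition rdot (p q : R[i]) : R :=
  complex.Re p * complex.Re q + complex.Im p * complex.Im q.

Lemma ReZconj (t : R) (p q : R[i]) :
  complex.Re (t%:C * (p * Num.conj q)) = t * rdot p q.
Proof.
rewrite -[Num.conj q]/(conjc q) /rdot; case: p => p1 p2; case: q => q1 q2 /=; ring.
Qed.

Lemma rdotZ (s t : R) (p q : R[i]) : rdot (s%:C * p) (t%:C * q) = s * t * rdot p q.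
Proof. by rewrite /rdot; case: p => p1 p2; case: q => q1 q2 /=; ring. Qed.

Lemma rdotZr (t : R) (p q : R[i]) : rdot p (t%:C * q) = t * rdot p q.
Proof. by rewrite -[p in LHS]mul1r (rdotZ 1) mul1r. Qed.

Lemma rdotC p q : rdot p q = rdot q p.
Proof. by rewrite /rdot; ring. Qed.

Lemma rdot_ge0 p : 0 <= rdot p p.
Proof. by rewrite /rdot; nra. Qed.

Lemma rtr_specmxl U W f X Y : W \is unitarymx -> Y \is hermsymmx ->
  rtr (specmx U (fun i => (f i)%:C) *m (X *m Y)) =
  \sum_i \sum_j f i * rdot ((U *m X *m W^t*) i j) ((U *m Y *m W^t*) i j).
Proof.
move=> uW hY; rewrite /rtr (mxtrace_specmxMl _ _ _ uW hY).
rewrite raddf_sum; apply: eq_bigr => i _; rewrite raddf_sum.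
by apply: eq_bigr => j _; exact: ReZconj.
Qed.

Lemma rtr_specmxr U W f X Y : U \is unitarymx -> X \is hermsymmx ->
  rtr (specmx W (fun i => (f i)%:C) *m (X *m Y)) =
  \sum_i \sum_j f j * rdot ((U *m X *m W^t*) i j) ((U *m Y *m W^t*) i j).
Proof.
move=> uU hX; rewrite /rtr (mxtrace_specmxMr _ _ _ uU hX).
rewrite raddf_sum; apply: eq_bigr => i _; rewrite raddf_sum.
apply: eq_bigr => j _.
by rewrite (mulrC (Num.conj _)) rdotC; exact: ReZconj.
Qed.

Lemma hermsymmx1 : (1%:M : 'M[R[i]]_d) \is hermsymmx.
Proof. by apply/hermsymmxP; rewrite trmx1 map_mx1. Qed.

Lemma hermsymmxB A B : A \is hermsymmx -> B \is hermsymmx -> A - B \is hermsymmx.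
Proof.
move=> /hermsymmxP hA /hermsymmxP hB; apply/hermsymmxP.
by rewrite raddfB map_mxB hA hB.
Qed.

Lemma hermsymmxZ (t : R) A : A \is hermsymmx -> t%:C *: A \is hermsymmx.
Proof.
move=> /hermsymmxP hA; apply/hermsymmxP.
rewrite linearZ/= map_mxZ hA; congr (_ *: _).
by apply: (@conj_Creal R[i]); apply/complex_realP; exists t.
Qed.

(** One pair of eigenvalues [a], [b] in [rtr_expmx_sub_le]: in the mixed basis [c1 + i c2] is the
    entry of [X], [q1 + i q2] that of the identity, and [a - b] times the latter is the entry of
    [A - B]. *)
Lemma trace_ineq_scalar (s a b c1 c2 q1 q2 : R) : 0 < s ->
  (expR a - expR b) * (c1 * q1 + c2 * q2) <=
  4^-1 * (s * ((a - b) ^+ 2 * (q1 ^+ 2 + q2 ^+ 2)) + s^-1 * (c1 ^+ 2 + c2 ^+ 2))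
  * (expR a + expR b).
Proof.
move=> s0; have := expR_dist_le a b.
set E := expR a + expR b; set p := c1 * q1 + c2 * q2.
set K := s * _ + _ => dE.
have E0 : 0 < E by rewrite addr_gt0 ?expR_gt0.
(* AM-GM together with Cauchy-Schwarz *)
have pK : 2 * (`|a - b| * `|p|) <= K.
  have K0 : 0 <= K.
    rewrite addr_ge0// mulr_ge0 ?invr_ge0 ?(ltW s0)//; last nra.
    by rewrite mulr_ge0 ?sqr_ge0// addr_ge0 ?sqr_ge0.
  have P0 : 0 <= 2 * (`|a - b| * `|p|) by rewrite !mulr_ge0.
  rewrite -(ler_sqr P0 K0) !exprMn -!normrX !ger0_norm ?sqr_ge0//.
  set x := a - b; set u := q1 ^+ 2 + q2 ^+ 2; set v := c1 ^+ 2 + c2 ^+ 2.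
  have puv : p ^+ 2 <= u * v by rewrite /p /u /v; have := sqr_ge0 (c1 * q2 - c2 * q1); nra.
  have -> : K ^+ 2 = (s * (x ^+ 2 * u) - s^-1 * v) ^+ 2 + 4 * (x ^+ 2 * (u * v)).
    by rewrite /K -/x -/u -/v; field; rewrite gt_eqF.
  have := ler_wpM2l (sqr_ge0 x) puv; have := sqr_ge0 (s * (x ^+ 2 * u) - s^-1 * v).
  lra.
apply: (le_trans (ler_norm _)); rewrite normrM.
have := ler_wpM2r (ltW E0) pK; have := ler_wpM2r (normr_ge0 p) dE.
lra.
Qed.

(** All six traces are expanded over the same pairs of an eigenvector of [A] and one of [B], and
    then compared pair by pair. The weight [s] stays free because its best value depends on the
    position in the chain. *)
Lemma rtr_expmx_sub_le (s : R) A B X : 0 < s ->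
  A \is hermsymmx -> B \is hermsymmx -> X \is hermsymmx ->
  rtr (expmx A *m X) - rtr (expmx B *m X) <=
  4^-1 * (s * (rtr (expmx A *m ((A - B) *m (A - B))) +
               rtr (expmx B *m ((A - B) *m (A - B))))
          + s^-1 * (rtr (expmx A *m (X *m X)) + rtr (expmx B *m (X *m X)))).
Proof.
move=> s0 hA hB hX; have hD := hermsymmxB hA hB.
have [U [a [uU AE ->]]] := hermsymmx_spectral hA.
have [W [b [uW BE ->]]] := hermsymmx_spectral hB.
set eA := specmx U _; set eB := specmx W _; set D := A - B.
pose p i j := (U *m X *m W^t*) i j; pose q i j := (U *m 1%:M *m W^t*) i j.
have DE i j : (U *m D *m W^t*) i j = (a i - b j)%:C * q i j.
  by rewrite /D AE BE (conj_specmxB _ _ _ _ uU uW) [in RHS]rmorphB.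
have -> : rtr (eA *m X) = \sum_i \sum_j expR (a i) * rdot (p i j) (q i j).
  by rewrite -[X in rtr (_ *m X)]mulmx1 (rtr_specmxl _ _ _ uW hermsymmx1).
have -> : rtr (eB *m X) = \sum_i \sum_j expR (b j) * rdot (p i j) (q i j).
  rewrite -[X in rtr (_ *m X)]mul1mx (rtr_specmxr _ _ _ uU hermsymmx1).
  by apply: eq_bigr => i _; apply: eq_bigr => j _; rewrite rdotC.
rewrite !(rtr_specmxl U _ _ uW hX) !(rtr_specmxr W _ _ uU hX).
rewrite !(rtr_specmxl U _ _ uW hD) !(rtr_specmxr W _ _ uU hD).
rewrite -sumrB -!big_split/= !mulr_sumr -big_split/= mulr_sumr; apply: ler_sum => i _.
rewrite -sumrB -!big_split/= !mulr_sumr -big_split/= mulr_sumr; apply: ler_sum => j _.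
rewrite DE rdotZ -/(p i j).
have := trace_ineq_scalar (a i) (b j) (complex.Re (p i j)) (complex.Im (p i j))
  (complex.Re (q i j)) (complex.Im (q i j)) s0.
rewrite /rdot -!expr2.
move: (complex.Re (p i j)) (complex.Im (p i j)) => p1 p2.
by move: (complex.Re (q i j)) (complex.Im (q i j)) => q1 q2; lra.
Qed.

Lemma rtr_expmx_scale_sub_le (s t : R) A B X : 0 < s ->
  A \is hermsymmx -> B \is hermsymmx -> X \is hermsymmx ->
  rtr (expmx (t%:C *: A) *m X) - rtr (expmx (t%:C *: B) *m X) <=
  4^-1 * (s * (t ^+ 2 * (rtr (expmx (t%:C *: A) *m ((A - B) *m (A - B))) +
                         rtr (expmx (t%:C *: B) *m ((A - B) *m (A - B)))))
          + s^-1 * (rtr (expmx (t%:C *: A) *m (X *m X)) +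
                    rtr (expmx (t%:C *: B) *m (X *m X)))).
Proof.
move=> s0 hA hB hX.
have := rtr_expmx_sub_le s0 (hermsymmxZ t hA) (hermsymmxZ t hB) hX.
rewrite -scalerBr; move: (A - B) (expmx _) (expmx _) => D eA eB.
have sqrZ (e : 'M[R[i]]_d) :
    rtr (e *m ((t%:C *: D) *m (t%:C *: D))) = t ^+ 2 * rtr (e *m (D *m D)).
  by rewrite -scalemxAl -!scalemxAr !rtrZ mulrA expr2.
by rewrite !sqrZ -mulrDr.
Qed.

(** The tangent-line inequality for [exp] at [a i], evaluated at [b j - l], is averaged with the
    nonnegative weights [q i j]. Three choices matter later: [A = 0] gives lower bounds on trace
    exponentials, [l = 0] gives convexity in the parameter, and [l = L] gives the variational bound
    on the proxy. *)
Lemma rtr_klein (l : R) A B : A \is hermsymmx -> B \is hermsymmx ->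
  rtr (expmx A *m B) - rtr (expmx A *m A) - l * rtr (expmx A) <=
  expR (- l) * rtr (expmx B) - rtr (expmx A).
Proof.
move=> hA hB.
have [U [a [uU AE ->]]] := hermsymmx_spectral hA.
have [W [b [uW BE ->]]] := hermsymmx_spectral hB.
pose q i j := rdot ((U *m 1%:M *m W^t*) i j) ((U *m 1%:M *m W^t*) i j).
set eA := specmx U _; set eB := specmx W _.
have -> : rtr (eA *m B) = \sum_i \sum_j expR (a i) * (b j * q i j).
  rewrite -[B]mul1mx (rtr_specmxl _ _ _ uW hB); apply: eq_bigr => i _.
  by apply: eq_bigr => j _; rewrite BE (conj_specmxr _ _ _ _ uW) rdotZr.
have -> : rtr (eA *m A) = \sum_i \sum_j expR (a i) * (a i * q i j).
  rewrite -[A]mul1mx (rtr_specmxl _ _ _ uW hA); apply: eq_bigr => i _.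
  by apply: eq_bigr => j _; rewrite AE (conj_specmxl _ _ _ _ uU) rdotZr.
have -> : rtr eA = \sum_i \sum_j expR (a i) * q i j.
  by rewrite -[eA]mulmx1 -[1%:M]mulmx1 (rtr_specmxl _ _ _ uW hermsymmx1).
have -> : rtr eB = \sum_i \sum_j expR (b j) * q i j.
  by rewrite -[eB]mulmx1 -[1%:M]mulmx1 (rtr_specmxr _ _ _ uU hermsymmx1).
rewrite !mulr_sumr -!sumrB; apply: ler_sum => i _.
rewrite !mulr_sumr -!sumrB; apply: ler_sum => j _.
have := expR_klein (a i) (- l + b j); rewrite expRD.
have := rdot_ge0 ((U *m 1%:M *m W^t*) i j); rewrite -/(q i j).
move=> q0 /(ler_wpM2r q0); lra.
Qed.

Lemma rtr_expmx_sqr_ge0 A X : A \is hermsymmx -> X \is hermsymmx ->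
  0 <= rtr (expmx A *m (X *m X)).
Proof.
move=> /hermsymmx_spectral[U [a [uU _ ->]]] hX.
rewrite (rtr_specmxl _ _ _ uU hX); apply: sumr_ge0 => i _; apply: sumr_ge0 => j _.
by rewrite mulr_ge0 ?expR_ge0// rdot_ge0.
Qed.

Lemma expmx0 : expmx (0 : 'M[R[i]]_d) = 1%:M.
Proof.
have u1 : (1%:M : 'M[R[i]]_d) \is unitarymx.
  by apply/unitarymxP; rewrite trmx1 map_mx1 mulmx1.
have -> : 0 = specmx (1%:M : 'M[R[i]]_d) (fun=> (0 : R)%:C).
  have := @specmxZ _ _ (1%:M : 'M[R[i]]_d) (fun=> (0 : R)%:C) 0.
  by rewrite scale0r => ->; congr specmx; apply/funext => i; rewrite mul0r.
by rewrite (expmx_specmx _ u1) expR0; exact: specmx1.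
Qed.

Lemma rtr_expmx_ge A : A \is hermsymmx -> d%:R + rtr A <= rtr (expmx A).
Proof.
move=> hA; have h0 : (0 : 'M[R[i]]_d) \is hermsymmx.
  by apply/hermsymmxP; rewrite trmx0 map_mx0.
have := rtr_klein 0 h0 hA.
rewrite expmx0 !mul1mx oppr0 expR0 mul1r mul0r subr0.
have -> : rtr (0 : 'M[R[i]]_d) = 0 by rewrite /rtr mxtrace0.
have -> : rtr (1%:M : 'M[R[i]]_d) = d%:R.
  by rewrite /rtr mxtrace1 (_ : d%:R = (d%:R)%:C) //= rmorph_nat.
lra.
Qed.

Lemma rtr_sqr_ge0 X : X \is hermsymmx -> 0 <= rtr (X *m X).
Proof.
move=> hX; have h0 : (0 : 'M[R[i]]_d) \is hermsymmx.
  by apply/hermsymmxP; rewrite trmx0 map_mx0.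
by have := rtr_expmx_sqr_ge0 h0 hX; rewrite expmx0 mul1mx.
Qed.

End trace_inequalities.

(** * Bounded measurable functions and their means *)

Section bounded_measurable.
Context {R : realType}.

(** This class is closed under products and partial integration, and its members are integrable for
    every probability, so linearity and Fubini require no separate integrability arguments. *)
Definition bmeas d (T : measurableType d) (f : T -> R) : Prop :=
  measurable_fun setT f /\ exists M, forall x, `|f x| <= M.

Section closure.
Context {d} {T : measurableType d}.
Implicit Types f g : T -> R.

Lemma bmeas_cst c : bmeas (fun _ : T => c).
Proof. by split; [exact: measurable_cst|exists `|c|]. Qed.

Lemma bmeasD f g : bmeas f -> bmeas g -> bmeas (fun x => f x + g x).
Proof.
move=> [mf [M fM]] [mg [N gN]]; split; first exact: measurable_funD.
by exists (M + N) => x; rewrite (le_trans (ler_normD _ _))// lerD.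
Qed.

Lemma bmeasM f g : bmeas f -> bmeas g -> bmeas (fun x => f x * g x).
Proof.
move=> [mf [M fM]] [mg [N gN]]; split; first exact: measurable_funM.
by exists (M * N) => x; rewrite normrM ler_pM.
Qed.

Lemma bmeasZ c f : bmeas f -> bmeas (fun x => c * f x).
Proof. by move=> bf; apply: bmeasM => //; exact: bmeas_cst. Qed.

Lemma bmeasN f : bmeas f -> bmeas (fun x => - f x).
Proof. by move=> /(bmeasZ (-1)); under eq_fun do rewrite mulN1r. Qed.

Lemma bmeasB f g : bmeas f -> bmeas g -> bmeas (fun x => f x - g x).
Proof. by move=> bf bg; apply: bmeasD => //; exact: bmeasN. Qed.

Lemma bmeas_sum I (s : seq I) (p : pred I) (f : I -> T -> R) :
  (forall i, bmeas (f i)) -> bmeas (fun x => \sum_(i <- s | p i) f i x).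
Proof.
move=> bf; elim: s => [|i s IH].
  by under eq_fun do rewrite big_nil; exact: bmeas_cst.
under eq_fun do rewrite big_cons.
by case: (p i) => //; exact: bmeasD.
Qed.

Lemma bmeas_comp d' (T' : measurableType d') (h : T' -> T) f :
  measurable_fun setT h -> bmeas f -> bmeas (f \o h).
Proof.
move=> mh [mf [M fM]]; split; first exact: measurableT_comp.
by exists M => x; exact: fM.
Qed.

Lemma bmeas_integrable (P : probability T R) f : bmeas f ->
  P.-integrable setT (EFin \o f).
Proof.
move=> [mf [M fM]]; apply: measurable_bounded_integrable => //.
  by apply: (le_lt_trans (probability_le1 P measurableT)); rewrite ltry.
by exists M; split; [exact: num_real|move=> N MN x _; exact: (le_trans (fM x) (ltW MN))].
Qed.

End closure.

Section mean.
Context {d} {T : measurableType d}.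
Implicit Types (f g : T -> R) (P : probability T R).

Lemma EFin_mean P f : bmeas f ->
  (\int[P]_x f x)%:E = (\int[P]_x (f x)%:E)%E.
Proof.
by move=> bf; rewrite /Rintegral fineK//; apply: integrable_fin_num => //;
  exact: bmeas_integrable.
Qed.

Lemma meanD P f g : bmeas f -> bmeas g ->
  \int[P]_x (f x + g x) = \int[P]_x f x + \int[P]_x g x.
Proof. by move=> bf bg; rewrite RintegralD//; exact: bmeas_integrable. Qed.

Lemma meanB P f g : bmeas f -> bmeas g ->
  \int[P]_x (f x - g x) = \int[P]_x f x - \int[P]_x g x.
Proof. by move=> bf bg; rewrite RintegralB//; exact: bmeas_integrable. Qed.

Lemma meanZ P c f : bmeas f -> \int[P]_x (c * f x) = c * \int[P]_x f x.
Proof. by move=> bf; rewrite RintegralZl//; exact: bmeas_integrable. Qed.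

Lemma mean_cst P c : \int[P]_x c = c.
Proof. by rewrite Rintegral_cst//= probability_setT/= mulr1. Qed.

Lemma mean_sum P I (s : seq I) (p : pred I) (f : I -> T -> R) :
  (forall i, bmeas (f i)) ->
  \int[P]_x (\sum_(i <- s | p i) f i x) = \sum_(i <- s | p i) \int[P]_x f i x.
Proof.
move=> bf; elim: s => [|i s IH].
  by under eq_Rintegral do rewrite big_nil; rewrite big_nil mean_cst.
under eq_Rintegral do rewrite big_cons.
rewrite big_cons; case: (p i) => //.
by rewrite meanD ?IH//; exact: bmeas_sum.
Qed.

Lemma le_mean P f g : bmeas f -> bmeas g -> (forall x, f x <= g x) ->
  \int[P]_x f x <= \int[P]_x g x.
Proof. by move=> bf bg fg; rewrite le_Rintegral//; exact: bmeas_integrable. Qed.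

Lemma eq_mean P f g : (forall x, f x = g x) -> \int[P]_x f x = \int[P]_x g x.
Proof. by move=> fg; apply: eq_Rintegral => x _; exact: fg. Qed.

End mean.

Section product.
Context {d1 d2} {T1 : measurableType d1} {T2 : measurableType d2}.
Implicit Types (P : probability T1 R) (Q : probability T2 R).

Lemma bmeas_section (f : T1 * T2 -> R) x : bmeas f -> bmeas (fun y => f (x, y)).
Proof. by move=> bf; apply: (bmeas_comp _ bf); exact: pair1_measurable. Qed.

Lemma bmeas_mean Q (f : T1 * T2 -> R) : bmeas f -> bmeas (fun x => \int[Q]_y f (x, y)).
Proof.
move=> bf; have [mf [M fM]] := bf.
have bfx x : bmeas (fun y => f (x, y)) by exact: bmeas_section.
have bcst c : bmeas (fun _ : T2 => c) by exact: bmeas_cst.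
split; last first.
  exists M => x; rewrite ler_norml; apply/andP; split.
    rewrite -[leLHS](mean_cst Q) le_mean// => y.
    by have := fM (x, y); rewrite ler_norml => /andP[].
  rewrite -[leRHS](mean_cst Q) le_mean// => y.
  by have := fM (x, y); rewrite ler_norml => /andP[].
apply/measurable_EFinP.
(* Tonelli's measurability of partial integrals concerns nonnegative integrands, hence the shift of
   [f] by its bound [M]. *)
rewrite (_ : _ \o _ = fun x => (\int[Q]_y (f (x, y) + M)%:E - M%:E)%E); last first.
  apply/funext => x /=; rewrite -(EFin_mean _ (bmeasD (bfx x) (bcst M))).
  by rewrite meanD// mean_cst -EFinB addrK.
apply: emeasurable_funB; last exact: measurable_cst.
apply: (@measurable_fun_fubini_tonelli_F _ _ _ _ _ Q (fun z => (f z + M)%:E)).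
  by apply/measurable_EFinP; apply: measurable_funD.
by move=> z; rewrite lee_fin; have := fM z; rewrite ler_norml => /andP[]; lra.
Qed.

Lemma mean_prod P Q (f : T1 * T2 -> R) : bmeas f ->
  \int[P]_x \int[Q]_y f (x, y) = \int[(P \x Q)%E]_z f z.
Proof.
move=> bf; rewrite /Rintegral; congr fine.
rewrite -(@integral12_prod_meas1 _ _ _ _ _ P Q (EFin \o f)); last first.
  exact: (bmeas_integrable (P \x Q)%E).
apply: eq_integral => x _; rewrite -/(Rintegral _ _ _) EFin_mean//.
exact: bmeas_section.
Qed.

End product.
End bounded_measurable.

Section bounded_measurable_matrices.
Context {R : realType} {dT : measure_display} {T : measurableType dT}.

Definition cbmeas (f : T -> R[i]) : Prop :=
  bmeas (fun t => complex.Re (f t)) /\ bmeas (fun t => complex.Im (f t)).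

Lemma cbmeas_cst c : cbmeas (fun=> c).
Proof. by split; exact: bmeas_cst. Qed.

Lemma cbmeasD f g : cbmeas f -> cbmeas g -> cbmeas (fun t => f t + g t).
Proof.
move=> [f1 f2] [g1 g2]; split.
  rewrite (_ : (fun t => _) = fun t => complex.Re (f t) + complex.Re (g t)).
    exact: bmeasD.
  by apply/funext => t; rewrite raddfD.
rewrite (_ : (fun t => _) = fun t => complex.Im (f t) + complex.Im (g t)).
  exact: bmeasD.
by apply/funext => t; rewrite raddfD.
Qed.

Lemma cbmeasM f g : cbmeas f -> cbmeas g -> cbmeas (fun t => f t * g t).
Proof.
move=> [f1 f2] [g1 g2]; split.
  rewrite (_ : (fun t => _) = fun t =>
      complex.Re (f t) * complex.Re (g t) - complex.Im (f t) * complex.Im (g t)).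
    by apply: bmeasB; exact: bmeasM.
  by apply/funext => t; case: (f t) => a b; case: (g t).
rewrite (_ : (fun t => _) = fun t =>
    complex.Re (f t) * complex.Im (g t) + complex.Im (f t) * complex.Re (g t)).
  by apply: bmeasD; exact: bmeasM.
by apply/funext => t; case: (f t) => a b; case: (g t).
Qed.

Lemma cbmeas_sum I (s : seq I) (f : I -> T -> R[i]) :
  (forall i, cbmeas (f i)) -> cbmeas (fun t => \sum_(i <- s) f i t).
Proof.
move=> bf; elim: s => [|i s IH].
  by under eq_fun do rewrite big_nil; exact: cbmeas_cst.
by under eq_fun do rewrite big_cons; exact: cbmeasD.
Qed.

Context {d : nat}.
Implicit Types F G : T -> 'M[R[i]]_d.

Definition mxbmeas F : Prop := forall i j, cbmeas (fun t => F t i j).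

Lemma mxbmeas_cst A : mxbmeas (fun=> A).
Proof. by move=> i j; exact: cbmeas_cst. Qed.

Lemma mxbmeasD F G : mxbmeas F -> mxbmeas G -> mxbmeas (fun t => F t + G t).
Proof.
move=> bF bG i j; rewrite (_ : (fun t => _) = fun t => F t i j + G t i j).
  exact: cbmeasD.
by apply/funext => t; rewrite mxE.
Qed.

Lemma mxbmeasZ c F : mxbmeas F -> mxbmeas (fun t => c *: F t).
Proof.
move=> bF i j; rewrite (_ : (fun t => _) = fun t => c * F t i j).
  by apply: cbmeasM => //; exact: cbmeas_cst.
by apply/funext => t; rewrite mxE.
Qed.

Lemma mxbmeasB F G : mxbmeas F -> mxbmeas G -> mxbmeas (fun t => F t - G t).
Proof.
move=> bF bG; have := mxbmeasD bF (mxbmeasZ (-1) bG).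
by under eq_fun do rewrite scaleN1r.
Qed.

Lemma mxbmeasM F G : mxbmeas F -> mxbmeas G -> mxbmeas (fun t => F t *m G t).
Proof.
move=> bF bG i j; rewrite (_ : (fun t => _) = fun t => \sum_k F t i k * G t k j).
  by apply: cbmeas_sum => k; exact: cbmeasM.
by apply/funext => t; rewrite mxE.
Qed.

Lemma mxbmeasX F k : mxbmeas F -> mxbmeas (fun t => F t ^+ k).
Proof.
move=> bF; elim: k => [|k IH]; first exact: (mxbmeas_cst 1%:M).
by under eq_fun do rewrite exprS; exact: mxbmeasM.
Qed.

Lemma mxbmeas_sum I (s : seq I) (F : I -> T -> 'M[R[i]]_d) :
  (forall i, mxbmeas (F i)) -> mxbmeas (fun t => \sum_(i <- s) F i t).
Proof.
move=> bF; elim: s => [|i s IH].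
  by under eq_fun do rewrite big_nil; exact: mxbmeas_cst.
by under eq_fun do rewrite big_cons; exact: mxbmeasD.
Qed.

Lemma bmeas_rtr F : mxbmeas F -> bmeas (fun t => rtr (F t)).
Proof. by move=> bF; have [] := @cbmeas_sum _ (index_enum 'I_d) _ (fun i => bF i i). Qed.

End bounded_measurable_matrices.

Section exponential_of_bounded_measurable.
Context {R : realType} {d : nat}.

(** The bound sees [A] only through [tr A^2], so it is uniform over a bounded family of matrices.
    Every eigenvalue is at most [1 + tr A^2], and unitary matrices have entries of modulus at most
    1. *)
Lemma expmx_entry_le (A : 'M[R[i]]_d) i j : A \is hermsymmx ->
  `|expmx A i j| <= (d%:R * expR (1 + rtr (A *m A)))%:C.
Proof.
move=> /hermsymmx_spectral[U [a [uU -> ->]]].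
have -> : rtr (specmx U (fun k => (a k)%:C) *m specmx U (fun k => (a k)%:C)) =
    \sum_k a k ^+ 2.
  rewrite (specmxM _ _ uU) /rtr (mxtrace_specmx _ uU) raddf_sum.
  by apply: eq_bigr => k _; rewrite /= mul0r subr0 expr2.
set s := \sum_i _; have as_ k : a k <= 1 + s.
  have : a k ^+ 2 <= s.
    by rewrite /s (bigD1 k)//= lerDl sumr_ge0// => l _; rewrite sqr_ge0.
  have := sqr_ge0 (a k - 1); nra.
rewrite specmxE (le_trans (ler_norm_sum _ _ _))//.
have -> : d%:R * expR (1 + s) = \sum_(k < d) expR (1 + s).
  by rewrite sumr_const card_ord mulr_natl.
rewrite rmorph_sum; apply: ler_sum => k _.
rewrite !normrM norm_conjC.
have e0 : 0 <= (expR (a k))%:C :> R[i] by rewrite ler0c expR_ge0.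
apply: (@le_trans _ _ (expR (a k))%:C); last by rewrite lecR ler_expR.
rewrite (ger0_norm e0) -[leRHS]mulr1 -[X in _ <= X * 1]mul1r.
by rewrite ler_pM ?mulr_ge0// ?ler_pM// unitarymx_entry_le1.
Qed.

Context {dT : measure_display} {T : measurableType dT}.

Lemma mxbmeas_series (F : T -> 'M[R[i]]_d) n : mxbmeas F ->
  mxbmeas (fun t => series (fun k : nat => (k`!%:R)^-1 *: F t ^+ k) n).
Proof. by move=> bF; apply: mxbmeas_sum => k; apply: mxbmeasZ; exact: mxbmeasX. Qed.

Lemma mxbmeas_expmx (F : T -> 'M[R[i]]_d) : (forall t, F t \is hermsymmx) ->
  mxbmeas F -> mxbmeas (fun t => expmx (F t)).
Proof.
move=> hF bF i j.
have [_ [M sM]] := bmeas_rtr (mxbmeasM bF bF).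
have eM t : `|expmx (F t) i j| <= (d%:R * expR (1 + M))%:C.
  rewrite (le_trans (expmx_entry_le i j (hF t)))// lecR ler_wpM2l// ler_expR lerD2l.
  exact: le_trans (ler_norm _) (sM t).
have cv (t : T) := @cvg_series_hermsymmx _ _ (F t) i j (hF t).
split; split.
- apply: (@measurable_fun_cvg _ _ _ _ (fun n t => complex.Re
    (series (fun k : nat => (k`!%:R)^-1 *: F t ^+ k) n i j))).
    by move=> n; have [[]] := mxbmeas_series n bF i j.
  by move=> t _; exact: (cvg_complex_Re (cv t)).
- exists (d%:R * expR (1 + M)) => t; rewrite -lecR; apply: le_trans (eM t).
  exact: normc_ge_Re.
- apply: (@measurable_fun_cvg _ _ _ _ (fun n t => complex.Im
    (series (fun k : nat => (k`!%:R)^-1 *: F t ^+ k) n i j))).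
    by move=> n; have [_ []] := mxbmeas_series n bF i j.
  by move=> t _; exact: (cvg_complex_Im (cv t)).
- exists (d%:R * expR (1 + M)) => t; rewrite -lecR; apply: le_trans (eM t).
  by rewrite normc_def lecR -sqrtr_sqr ler_wsqrtr// lerDr sqr_ge0.
Qed.

End exponential_of_bounded_measurable.

(** * Averages over all orderings of the coordinates *)

Section permutation_chains.
Context {n : nat}.
Implicit Types (s : {perm 'I_n}) (i j k : 'I_n).

Definition chain s (k : nat) : {set 'I_n} := s @: [set i : 'I_n | (i < k)%N]%SET.

Lemma chain0 s : chain s 0 = finset.set0.
Proof. by rewrite /chain (_ : finset _ = finset.set0) ?imset0//; apply/setP => i; rewrite !inE. Qed.

Lemma chain_full s : chain s n = [set: 'I_n]%SET.
Proof.
apply/setP => i; rewrite inE; apply/imsetP; exists (s^-1%g i); last by rewrite permKV.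
by rewrite inE.
Qed.

Lemma mem_chain s i (k : nat) : (s i \in chain s k) = (i < k)%N.
Proof. by rewrite mem_imset ?inE//; exact: perm_inj. Qed.

Lemma chain_pred s k : chain s k = chain s k.+1 :\ s k.
Proof.
apply/setP => i; rewrite -(permKV s i) !inE !mem_chain (inj_eq (@perm_inj _ s)) ltnS.
by rewrite (ltn_neqAle (s^-1 i)%g k).
Qed.

(** A transposition of two positions up to [k] permutes the first [k+1] positions among themselves.
    It is the symmetry behind [sum_chain_average]. *)
Lemma chain_tperm s i k : (i <= k)%N -> chain (tperm i k * s)%g k.+1 = chain s k.+1.
Proof.
move=> ik; apply/setP => j; rewrite -(permKV s j) mem_chain.
set l := (s^-1 j)%g; rewrite [X in X \in _](_ : _ = (tperm i k * s)%g (tperm i k l)).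
  by rewrite mem_chain; case: tpermP => [->|->|//]; rewrite ?ltnS ?ik ?leqnn.
by rewrite permM tpermK.
Qed.

Context {R : realFieldType}.

(** Given the set of its first [k+1] elements, a uniform ordering has its element at position [k]
    uniform in that set: transposing [k] with any [i <= k] keeps the set and brings [s i] to
    position [k]. *)
Lemma sum_chain_average (f : {set 'I_n} -> 'I_n -> R) k :
  k.+1%:R * \sum_s f (chain s k.+1) (s k) =
  \sum_s \sum_(j in chain s k.+1) f (chain s k.+1) j.
Proof.
under [RHS]eq_bigr => s _.
  rewrite big_imset/=; last by move=> x y _ _; exact: perm_inj.
  under eq_bigl do rewrite inE ltnS; over.
rewrite exchange_big/=.
transitivity (\sum_(i < n | (i <= k)%N) \sum_s f (chain s k.+1) (s k)).
  rewrite sumr_const mulr_natl; congr (_ *+ _).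
  transitivity (\sum_(i < n | (i < k.+1)%N) 1)%N; last by rewrite -sum1_card.
  by rewrite -(big_ord_widen n (fun=> 1%N)) ?ltn_ord// sum1_card card_ord.
apply: eq_bigr => i ik.
rewrite [RHS](reindex_inj (mulgI (tperm i k)))/=; apply: eq_bigr => s _.
by rewrite chain_tperm// permM tpermL.
Qed.

Lemma sum_perm_average (f : 'I_n -> R) k :
  n%:R * \sum_(s : {perm 'I_n}) f (s k) = #|{perm 'I_n}|%:R * \sum_j f j.
Proof.
transitivity (\sum_(i < n) \sum_(s : {perm 'I_n}) f (s i)).
  have -> : n%:R = #|'I_n|%:R :> R by rewrite card_ord.
  rewrite mulr_natl -sumr_const; apply: eq_bigr => i _.
  rewrite [RHS](reindex_inj (mulgI (tperm i k)))/=; apply: eq_bigr => s _.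
  by rewrite permM tpermL.
rewrite exchange_big/= mulr_natl -sumr_const; apply: eq_bigr => s _.
by rewrite [RHS](reindex_inj (@perm_inj _ s)).
Qed.

End permutation_chains.

Section chain_inequality.
Context {R : realType} {n : nat}.

Lemma sum_invsqrt_le (m : nat) :
  \sum_(k < m) (Num.sqrt (k.+1%:R : R))^-1 <= 2 * Num.sqrt m%:R.
Proof.
elim: m => [|m IH]; first by rewrite big_ord0 mulr_ge0// sqrtr_ge0.
rewrite big_ord_recr/=; apply: (le_trans (lerD IH (lexx _))).
set u := Num.sqrt m%:R; set v := Num.sqrt m.+1%:R.
have u2 : u ^+ 2 = m%:R by rewrite sqr_sqrtr.
have v2 : v ^+ 2 = m%:R + 1 by rewrite sqr_sqrtr// -natr1.
have v0 : 0 < v by rewrite sqrtr_gt0.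
have u0 : 0 <= u by exact: sqrtr_ge0.
(* Multiplied by [v], the claim [2 u + 1 / v <= 2 v] becomes [2 u v <= u^2 + v^2]. *)
rewrite -(ler_pM2r v0) mulrDl mulVf ?gt_eqF//; nra.
Qed.

(** The combinatorial core, stated for real numbers. At position [k] the average of [A] is at most
    [2 K / n] and that of [B] at most [2 K / (k+1)]. The two terms in the bound for [x] become equal
    for the chosen weight, and the result is summed with [sum_invsqrt_le]. *)
Lemma chain_inequality (A : 'I_n -> R) (B x : {set 'I_n} -> 'I_n -> R) (g K t : R) :
  0 < t ->
  (forall (S : {set 'I_n}) j s, j \in S -> 0 < s ->
    x S j <= 4^-1 * (s * (t ^+ 2 * A j) + s^-1 * B S j)) ->
  (forall s : {perm 'I_n}, g = \sum_(k < n) x (chain s k.+1) (s k)) ->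
  \sum_j A j <= 2 * K ->
  (forall S : {set 'I_n}, \sum_(j in S) B S j <= 2 * K) ->
  g <= 2 * t * K.
Proof.
move=> t0 xAB gx AK BK.
have K0 : 0 <= K by have := BK finset.set0; rewrite big_set0; lra.
pose N : R := #|{perm 'I_n}|%:R.
have N0 : 0 < N by rewrite ltr0n; apply/card_gt0P; exists 1%g.
rewrite -(ler_pM2l N0).
have -> : N * g = \sum_(k < n) \sum_(s : {perm 'I_n}) x (chain s k.+1) (s k).
  rewrite exchange_big/= mulr_natl -sumr_const; apply: eq_bigr => s _; exact: gx.
have term (k : 'I_n) : \sum_(s : {perm 'I_n}) x (chain s k.+1) (s k) <=
    N * t * K * ((Num.sqrt n%:R)^-1 * (Num.sqrt k.+1%:R)^-1).
  pose u : R := Num.sqrt n%:R; pose v : R := Num.sqrt k.+1%:R.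
  have n0 : (0 < n)%N := leq_ltn_trans (leq0n k) (ltn_ord k).
  have u0 : 0 < u by rewrite sqrtr_gt0 ltr0n.
  have v0 : 0 < v by rewrite sqrtr_gt0 ltr0n.
  have u2 : u ^+ 2 = n%:R by rewrite sqr_sqrtr.
  have v2 : v ^+ 2 = k.+1%:R by rewrite sqr_sqrtr.
  (* the weight balancing the two averages *)
  pose s0 := u / (v * t).
  have s00 : 0 < s0 by rewrite divr_gt0// mulr_gt0.
  apply: (@le_trans _ _ (\sum_(s : {perm 'I_n})
      4^-1 * (s0 * (t ^+ 2 * A (s k)) + s0^-1 * B (chain s k.+1) (s k)))).
    by apply: ler_sum => s _; apply: xAB => //; rewrite mem_chain.
  rewrite -mulr_sumr big_split/= -!mulr_sumr.
  have hA : \sum_(s : {perm 'I_n}) A (s k) <= (u ^+ 2)^-1 * (N * (2 * K)).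
    rewrite -(ler_pM2l (_ : 0 < u ^+ 2)) ?exprn_gt0// mulVKf ?gt_eqF ?exprn_gt0//.
    by rewrite u2 sum_perm_average ler_pM2l.
  have hB : \sum_(s : {perm 'I_n}) B (chain s k.+1) (s k) <= (v ^+ 2)^-1 * (N * (2 * K)).
    rewrite -(ler_pM2l (_ : 0 < v ^+ 2)) ?exprn_gt0// mulVKf ?gt_eqF ?exprn_gt0//.
    rewrite v2 sum_chain_average /N mulr_natl -sumr_const; apply: ler_sum => s _; exact: BK.
  have hA' := ler_wpM2l (ltW (mulr_gt0 s00 (exprn_gt0 2 t0))) hA.
  have s0V : 0 < s0^-1 by rewrite invr_gt0.
  have hB' := ler_wpM2l (ltW s0V) hB.
  rewrite -/u -/v mulrA.
  rewrite -[leRHS](_ : 4^-1 * (s0 * t ^+ 2 * ((u ^+ 2)^-1 * (N * (2 * K))) +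
    s0^-1 * ((v ^+ 2)^-1 * (N * (2 * K)))) = _); first by rewrite ler_pM2l// lerD.
  by rewrite /s0; field; rewrite !gt_eqF.
apply: (le_trans (ler_sum _ (fun k _ => term k))).
rewrite -!mulr_sumr; have [->|n0] := posnP n.
  by rewrite big_ord0 !mulr0 !mulr_ge0// ltW.
have u0 : 0 < Num.sqrt (n%:R : R) by rewrite sqrtr_gt0 ltr0n.
have := sum_invsqrt_le n; set S := \sum_(_ < _) _ => Sn.
have : (Num.sqrt n%:R)^-1 * S <= 2 by rewrite mulrC ler_pdivrMr.
have NtK : 0 <= N * t * K by rewrite !mulr_ge0// ltW.
by move=> /(ler_wpM2l NtK); rewrite !mulrA; lra.
Qed.

End chain_inequality.

(** * Entrywise means of random matrices *)

Section mean_matrix.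
Context {R : realType} {d : nat} {dT : measure_display} {T : measurableType dT}.
Implicit Types (F : T -> 'M[R[i]]_d) (A B : 'M[R[i]]_d) (P : probability T R).

Definition mean_mx P F : 'M[R[i]]_d :=
  \matrix_(i, j) ((\int[P]_t complex.Re (F t i j)) +i* (\int[P]_t complex.Im (F t i j))).

Lemma rtr_mulmxE A B : rtr (A *m B) = \sum_i \sum_k
  (complex.Re (A i k) * complex.Re (B k i) - complex.Im (A i k) * complex.Im (B k i)).
Proof.
rewrite /rtr raddf_sum; apply: eq_bigr => i _.
rewrite mxE raddf_sum; apply: eq_bigr => k _.
by case: (A i k) => a b; case: (B k i).
Qed.

Lemma rtr_mean_mx P A F : mxbmeas F ->
  rtr (A *m mean_mx P F) = \int[P]_t rtr (A *m F t).
Proof.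
move=> bF; rewrite rtr_mulmxE.
have bt i k : bmeas (fun t => complex.Re (A i k) * complex.Re (F t k i) -
    complex.Im (A i k) * complex.Im (F t k i)).
  by apply: bmeasB; apply: bmeasZ; have [] := bF k i.
under [RHS]eq_mean do rewrite rtr_mulmxE.
rewrite mean_sum; last by move=> i; exact: bmeas_sum.
apply: eq_bigr => i _; rewrite mean_sum//; apply: eq_bigr => k _.
have [b1 b2] := bF k i.
by rewrite meanB ?meanZ ?mxE//; exact: bmeasZ.
Qed.

Lemma mean_mx_herm P F : mxbmeas F -> (forall t, F t \is hermsymmx) -> mean_mx P F \is hermsymmx.
Proof.
move=> bF hF; apply/hermsymmxP/matrixP => i j; rewrite !mxE.
have Fij t : F t i j = conjc (F t j i).
  by have /hermsymmxP/matrixP/(_ i j) := hF t; rewrite !mxE => <-.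
apply/eqP; rewrite eq_complex /=; apply/andP; split; apply/eqP.
  by apply: eq_mean => t; rewrite Fij; case: (F t j i).
have [_ bI] := bF j i; rewrite -mulN1r -meanZ//; apply: eq_mean => t.
by rewrite Fij; case: (F t j i) => a b /=; rewrite mulN1r.
Qed.

End mean_matrix.

Lemma mxbmeas_mean_mx {R : realType} {d : nat} {d1 d2 : measure_display}
    {T1 : measurableType d1} {T2 : measurableType d2} (P : probability T2 R)
    (F : T1 * T2 -> 'M[R[i]]_d) :
  mxbmeas F -> mxbmeas (fun x => mean_mx P (fun y => F (x, y))).
Proof.
move=> bF i j; have [b1 b2] := bF i j; split.
  under eq_fun do rewrite mxE /=; exact: (@bmeas_mean _ _ _ _ _ P (fun z => complex.Re (F z i j))).
under eq_fun do rewrite mxE /=; exact: (@bmeas_mean _ _ _ _ _ P (fun z => complex.Im (F z i j))).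
Qed.

(** Primes denote the integrands after an exchange that preserves the law. It flips the sign of the
    mean of [x] and keeps those of [a] and [b], so averaging the pointwise bound doubles every term,
    and the factor 2 cancels. *)
Lemma mean_symmetrized_le {R : realType} {dT : measure_display} {T : measurableType dT}
    (P : probability T R) (x x' a a' b b' : T -> R) (s t X A B : R) :
  bmeas x -> bmeas x' -> bmeas a -> bmeas a' -> bmeas b -> bmeas b' ->
  X = \int[P]_u x u -> X = \int[P]_u (- x' u) ->
  A = \int[P]_u a u -> A = \int[P]_u a' u ->
  B = \int[P]_u b u -> B = \int[P]_u b' u ->
  (forall u, x u - x' u <= 4^-1 * (s * (t * (a u + a' u)) + s^-1 * (b u + b' u))) ->
  X <= 4^-1 * (s * (t * A) + s^-1 * B).
Proof.
move=> bx bx' ba ba' bb bb' X1 X2 A1 A2 B1 B2 le.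
have bA := bmeasD ba ba'; have bB := bmeasD bb bb'.
have bl := bmeasZ s (bmeasZ t bA); have br := bmeasZ s^-1 bB.
have := le_mean P (bmeasD bx (bmeasN bx')) (bmeasZ 4^-1 (bmeasD bl br)) le.
rewrite (meanD P bx (bmeasN bx')) (meanZ P _ (bmeasD bl br)) (meanD P bl br).
rewrite (meanZ P _ (bmeasZ t bA)) (meanZ P _ bA) (meanD P ba ba').
rewrite (meanZ P _ bB) (meanD P bb bb') -X1 -X2 -A1 -A2 -B1 -B2; lra.
Qed.

Lemma mean_fst {R : realType} {d1 d2 : measure_display} {T1 : measurableType d1}
    {T2 : measurableType d2} (P : probability T1 R) (Q : probability T2 R) (f : T1 -> R) :
  bmeas f -> \int[(P \x Q)%E]_u f u.1 = \int[P]_x f x.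
Proof.
move=> bf; rewrite -(mean_prod P Q (bmeas_comp measurable_fst bf)).
by apply: eq_mean => x; exact: (mean_cst Q (f x)).
Qed.

Lemma mean_klein_le {R : realType} {dT : measure_display} {T : measurableType dT}
    (P : probability T R) (a b c w : T -> R) (p t l k A B C W : R) :
  bmeas a -> bmeas b -> bmeas c -> bmeas w ->
  \int[P]_u a u = A -> \int[P]_u b u = B -> \int[P]_u c u = C -> \int[P]_u w u = W ->
  (forall u, p * a u - t * b u - l * c u <= k * w u - c u) ->
  p * A <= t * B + l * C + (k * W - C).
Proof.
move=> ba bb bc bw <- <- <- <- le.
have b1 := bmeasB (bmeasZ p ba) (bmeasZ t bb).
have := le_mean P (bmeasB b1 (bmeasZ l bc)) (bmeasB (bmeasZ k bw) bc) le.
rewrite (meanB P b1 (bmeasZ l bc)) (meanB P (bmeasZ p ba) (bmeasZ t bb)).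
rewrite (meanB P (bmeasZ k bw) bc) (meanZ P _ ba) (meanZ P _ bb) (meanZ P _ bc).
rewrite (meanZ P _ bw); lra.
Qed.

(** * Integration of a logarithmic growth bound *)

Section logarithmic_integration.
Context {R : realType}.

(** This is [ln (1 + y) <= y] at [y = x / (1 - x)], where [1 + y = 1 / (1 - x)]. *)
Lemma oppr_ln_le (x : R) : x < 1 -> - ln (1 - x) <= x / (1 - x).
Proof.
move=> x1; have x0 : 0 < 1 - x by rewrite subr_gt0.
rewrite -lnV ?posrE//.
have := @le_ln1Dx R (x / (1 - x)).
have -> : 1 + x / (1 - x) = (1 - x)^-1 by field; rewrite gt_eqF.
apply; rewrite -subr_gt0 opprK.
have -> : x / (1 - x) + 1 = (1 - x)^-1 by field; rewrite gt_eqF.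
by rewrite invr_gt0.
Qed.

(* A discrete form of: [m' <= c t m] implies [ln m(t) - ln m(0) <= c t^2 / 2]. *)
Lemma ln_increment_le (m : R -> R) (c t : R) : 0 <= c -> 0 <= t ->
  (forall x, 0 < m x) ->
  (forall a b, 0 <= a -> a <= b -> b <= t -> m b - m a <= (b - a) * (c * b * m b)) ->
  ln (m t) - ln (m 0) <= c * t ^+ 2 / 2.
Proof.
move=> c0 t0 m0 mab.
set Y := ln (m t) - ln (m 0); set k := c * t ^+ 2 / 2.
have k0 : 0 <= k by rewrite /k divr_ge0// mulr_ge0// sqr_ge0.
(* Cut [[0, t]] into [N] equal steps. Since [2 k = c t^2], the step ending at [(j+1) t / N]
   multiplies [m] by at most [1 / (1 - x)] with [x = 2 k (j+1) / N^2 <= del < 1], so [ln m] grows by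
   at most [x / (1 - del)]. The sum of these is [k (N+1) / (N - 2 k)]. *)
have step (N : nat) : 2 * k < N%:R -> Y * (N%:R - 2 * k) <= k * (N%:R + 1).
  move=> kN; have N0 : 0 < N%:R :> R by apply: le_lt_trans kN; lra.
  pose del := 2 * k / N%:R.
  have del1 : del < 1 by rewrite /del ltr_pdivrMr// mul1r.
  have ind (j : nat) : (j <= N)%N ->
      ln (m (j%:R * t / N%:R)) - ln (m 0) <=
      2 * k / N%:R ^+ 2 / (1 - del) * (j%:R * (j%:R + 1) / 2).
    elim: j => [|j IH] jN; first by rewrite !mul0r subrr mulr0.
    have {}IH := IH (ltnW jN).
    set b := j.+1%:R * t / N%:R; set a := j%:R * t / N%:R in IH.
    have ba : b - a = t / N%:R by rewrite /a /b -natr1; field; rewrite gt_eqF.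
    have j1N : j.+1%:R <= N%:R :> R by rewrite ler_nat.
    have bt : b <= t by rewrite /b ler_pdivrMr// mulrC ler_wpM2l.
    have a0 : 0 <= a by rewrite /a divr_ge0 ?mulr_ge0// ltW.
    have ab : a <= b by rewrite -subr_ge0 ba divr_ge0// ltW.
    have := mab a b a0 ab bt; rewrite ba.
    set x := 2 * k / N%:R ^+ 2 * j.+1%:R.
    have -> : t / N%:R * (c * b * m b) = x * m b.
      by rewrite /x /b /k; field; rewrite gt_eqF.
    move=> mx.
    have xdel : x <= del.
      rewrite /x /del expr2 invfM !mulrA -mulrA ler_piMr//.
        by rewrite divr_ge0 ?mulr_ge0// ltW.
      by rewrite mulrC ler_pdivrMr// mul1r.
    have x1 : x < 1 by exact: le_lt_trans xdel del1.
    have x0 : 0 <= x by rewrite /x mulr_ge0// divr_ge0 ?mulr_ge0// ?exprn_ge0// ltW.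
    have lnle : ln (1 - x) + ln (m b) <= ln (m a).
      rewrite -lnM ?posrE// ?subr_gt0// ler_ln ?posrE ?mulr_gt0// ?subr_gt0//.
      by lra.
    have := oppr_ln_le x1 => lx.
    have x2 : x / (1 - x) <= x / (1 - del).
      by rewrite ler_wpM2l// lef_pV2 ?posrE ?subr_gt0// lerB.
    have -> : 2 * k / N%:R ^+ 2 / (1 - del) * (j.+1%:R * (j.+1%:R + 1) / 2) =
        2 * k / N%:R ^+ 2 / (1 - del) * (j%:R * (j%:R + 1) / 2) + x / (1 - del).
      by rewrite /x -natr1; field; rewrite !gt_eqF// subr_gt0.
    by lra.
  have := ind N (leqnn N); rewrite mulrC mulrA mulVf ?gt_eqF// mul1r -/Y.
  have -> : 2 * k / N%:R ^+ 2 / (1 - del) * (N%:R * (N%:R + 1) / 2) =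
      k * (N%:R + 1) / (N%:R - 2 * k).
    by rewrite /del; field; rewrite !gt_eqF// subr_gt0.
  by rewrite ler_pdivlMr// subr_gt0.
rewrite leNgt; apply/negP => kY.
(* If [Y > k], a large [N] contradicts [step]: the reverse of its conclusion rearranges to
   [k + 2 k Y < N (Y - k)]. *)
have [N NE] : exists N : nat, 2 * k < N%:R /\ (k + 2 * k * Y) < N%:R * (Y - k).
  have [N1 N1E] : exists N : nat, 2 * k < N%:R.
    by exists (Num.truncn (2 * k)).+1; exact: truncnS_gt.
  have [N2 N2E] : exists N : nat, (k + 2 * k * Y) / (Y - k) < N%:R.
    by exists (Num.truncn ((k + 2 * k * Y) / (Y - k))).+1; exact: truncnS_gt.
  exists (N1 + N2)%N; rewrite natrD; split.
    by apply: (lt_le_trans N1E); rewrite lerDl.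
  rewrite -ltr_pdivrMr ?subr_gt0//; apply: (lt_le_trans N2E).
  by rewrite lerDr.
by case: NE => N1 N2; have := step N N1; lra.
Qed.

End logarithmic_integration.

(* [mix S z w] stands for the vector with the coordinates of [z] on [S] and
   those of [w] off [S]. *)
Record mixing {R : realType} {n : nat} {dE : measure_display} {E : measurableType dE}
    (mu : probability E R) (mix : {set 'I_n} -> E -> E -> E) : Prop := Mixing {
  measurable_mix : forall S, measurable_fun setT (fun u : E * E => mix S u.1 u.2) ;
  mixT : forall z w, mix [set: 'I_n]%SET z w = z ;
  mix0 : forall z w, mix finset.set0 z w = w ;
  mix_mix : forall S A z w, mix S (mix A z w) (mix A w z) =
    mix [set i | (i \in S) == (i \in A)]%SET z w ;
  mix_freshl : forall (S : {set 'I_n}) j z w y, j \in S -> mix S z (mix (~: [set j])%SET w y) = mix S z w ;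
  mix_freshr : forall (S : {set 'I_n}) j z w y, j \in S ->
    mix (S :\ j)%SET z (mix (~: [set j])%SET w y) = mix (~: [set j])%SET (mix S z w) y ;
  mean_mix : forall S (f : E * E -> R), bmeas f ->
    \int[(mu \x mu)%E]_u f u = \int[(mu \x mu)%E]_u f (mix S u.1 u.2, mix S u.2 u.1) }.

(** * The bound on the derivative of the trace moment, for an abstract mixing operation *)

Section core.
Context {R : realType} {n d : nat} {dE : measure_display} {E : measurableType dE}.
Variables (mu : probability E R) (mix : {set 'I_n} -> E -> E -> E).
Hypothesis mixP : mixing mu mix.
Variable G : E -> 'M[R[i]]_d.
Hypotheses (hG : forall z, G z \is hermsymmx) (bG : mxbmeas G) (G0 : mean_mx mu G = 0).
Local Notation mu2 := ((mu \x mu)%E : probability (E * E)%type R).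
Local Notation resample j z y := (mix (~: [set j])%SET z y).

Definition jump (j : 'I_n) (u : E * E) : 'M[R[i]]_d := G u.1 - G (resample j u.1 u.2).

(** Integrating out the resampled coordinate realises the conditional expectation given [Z] as an
    everywhere defined function of [z]; it can therefore be evaluated at hybrids too. *)
Definition proxy (z : E) : 'M[R[i]]_d :=
  (2^-1)%:C *: \sum_j mean_mx mu (fun y => jump j (z, y) *m jump j (z, y)).

Let h (S : {set 'I_n}) (u : E * E) := G (mix S u.1 u.2).
(** The increment of a chain at the moment when [j] is the last coordinate taken from [z]: the [C]
    of the overview. *)
Let hdiff S j u := h S u - h (S :\ j)%SET u.

Let mxbmeas_fst (F : E -> 'M[R[i]]_d) : mxbmeas F -> mxbmeas (fun u : E * E => F u.1).
Proof.
move=> bF i j; have [b1 b2] := bF i j.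
by split; [exact: (bmeas_comp measurable_fst b1)|exact: (bmeas_comp measurable_fst b2)].
Qed.

Let mxbmeas_mix (F : E -> 'M[R[i]]_d) S : mxbmeas F ->
  mxbmeas (fun u : E * E => F (mix S u.1 u.2)).
Proof.
move=> bF i j; have [b1 b2] := bF i j.
by split; [exact: (bmeas_comp (measurable_mix mixP S) b1)|
           exact: (bmeas_comp (measurable_mix mixP S) b2)].
Qed.

Let mxbmeas_jump j : mxbmeas (jump j).
Proof. by apply: mxbmeasB; [exact: mxbmeas_fst|exact: mxbmeas_mix]. Qed.

Let mxbmeas_hdiff S j : mxbmeas (hdiff S j).
Proof. by apply: mxbmeasB; exact: mxbmeas_mix. Qed.

Let herm_jump j u : jump j u \is hermsymmx.
Proof. exact: hermsymmxB. Qed.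

Let herm_hdiff S j u : hdiff S j u \is hermsymmx.
Proof. by rewrite /hdiff /h; apply: hermsymmxB; exact: hG. Qed.

Let hermsymmx_sqr (A : 'M[R[i]]_d) : A \is hermsymmx -> A *m A \is hermsymmx.
Proof.
by move=> /hermsymmxP hA; apply/hermsymmxP; rewrite trmx_mul map_mxM hA.
Qed.

Let mxbmeas_jump2 j : mxbmeas (fun u => jump j u *m jump j u).
Proof. by apply: mxbmeasM; exact: mxbmeas_jump. Qed.

Let bjump_section j z : mxbmeas (fun y => jump j (z, y) *m jump j (z, y)).
Proof.
move=> i k; have [b1 b2] := mxbmeas_jump2 j i k.
by split; [exact: (bmeas_section z b1)|exact: (bmeas_section z b2)].
Qed.

Lemma proxy_herm z : proxy z \is hermsymmx.
Proof.
rewrite /proxy; apply: hermsymmxZ; apply/hermsymmxP.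
rewrite raddf_sum (raddf_sum (map_mx _)) /=; apply: eq_bigr => j _; apply/hermsymmxP.
by apply: mean_mx_herm => [|y]; [exact: bjump_section|exact/hermsymmx_sqr/herm_jump].
Qed.

Lemma mxbmeas_proxy : mxbmeas proxy.
Proof.
apply: mxbmeasZ; apply: mxbmeas_sum => j.
exact: (mxbmeas_mean_mx mu (mxbmeas_jump2 j)).
Qed.

Let rtr_proxy A z : rtr (A *m proxy z) =
  2^-1 * \sum_j \int[mu]_y rtr (A *m (jump j (z, y) *m jump j (z, y))).
Proof.
rewrite /proxy -scalemxAr rtrZ; congr (_ * _).
rewrite mulmx_sumr rtr_sum; apply: eq_bigr => j _.
exact: (rtr_mean_mx mu A (bjump_section j z)).
Qed.

Section fixed_parameter.
Variables (theta psi : R).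
Hypotheses (theta_gt0 : 0 < theta) (psi_gt0 : 0 < psi) (d_gt0 : (0 < d)%N).
Let e z := expmx (theta%:C *: G z).

Let hermZG z : theta%:C *: G z \is hermsymmx.
Proof. exact: hermsymmxZ. Qed.

Let be : mxbmeas e.
Proof. exact: (mxbmeas_expmx hermZG (mxbmeasZ _ bG)). Qed.

Let brtr (F : E * E -> 'M[R[i]]_d) : mxbmeas F -> bmeas (fun u => rtr (e u.1 *m F u)).
Proof. by move=> bF; exact: (bmeas_rtr (mxbmeasM (mxbmeas_fst be) bF)). Qed.

(** These three means play the roles of [A], [B] and [x] in [chain_inequality]. *)
Let Aj j := \int[mu2]_u rtr (e u.1 *m (jump j u *m jump j u)).
Let BS S j := \int[mu2]_u rtr (e u.1 *m (hdiff S j u *m hdiff S j u)).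
Let xS S j := \int[mu2]_u rtr (e u.1 *m hdiff S j u).

Let swap_mem (S : {set 'I_n}) j : j \in S ->
  [set i | (i \in S) == (i \in (~: [set j])%SET)]%SET = (S :\ j)%SET.
Proof.
move=> jS; apply/setP => i; rewrite !inE.
by have [->|_] := eqVneq i j; rewrite ?jS //=; case: (i \in S).
Qed.

Let swap_notin (S : {set 'I_n}) j : j \in S ->
  [set i | (i \in (S :\ j)%SET) == (i \in (~: [set j])%SET)]%SET = S.
Proof.
move=> jS; apply/setP => i; rewrite !inE.
by have [->|_] := eqVneq i j; rewrite ?jS //=; case: (i \in S).
Qed.

(* Exchanging the [j]-th coordinates of [z] and [w] flips the sign of [hdiff]. *)
Lemma hdiff_increment (S : {set 'I_n}) j s : j \in S -> 0 < s ->
  xS S j <= 4^-1 * (s * (theta ^+ 2 * Aj j) + s^-1 * BS S j).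
Proof.
move=> jS s0; set A := (~: [set j])%SET.
pose sw (u : E * E) := (mix A u.1 u.2, mix A u.2 u.1).
have sw_hdiff u : hdiff S j (sw u) = - hdiff S j u.
  by rewrite /hdiff /h/= !(mix_mix mixP) swap_mem// swap_notin// opprB.
have sw_jump u : jump j (sw u) = - jump j u.
  rewrite /jump/= (mix_mix mixP) -/A.
  rewrite (_ : [set i | _]%SET = [set: 'I_n]%SET) ?(mixT mixP) ?opprB//.
  by apply/setP => i; rewrite !inE eqxx.
have NN (B : 'M[R[i]]_d) : - B *m - B = B *m B by rewrite mulNmx mulmxN opprK.
have bX := brtr (mxbmeas_hdiff S j).
have bX2 := brtr (mxbmeasM (mxbmeas_hdiff S j) (mxbmeas_hdiff S j)).
have bD2 := brtr (mxbmeas_jump2 j).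
have msw : measurable_fun setT sw.
  have m1 := measurable_mix mixP A.
  have m2 : measurable_fun setT (fun u : E * E => mix A u.2 u.1).
    exact: (measurableT_comp m1 (measurable_fun_pair measurable_snd measurable_fst)).
  exact: (measurable_fun_pair m1 m2).
have bsw f : bmeas f -> bmeas (fun u => f (sw u)) by move=> bf; exact: (bmeas_comp msw bf).
have E1 : xS S j = \int[mu2]_u (- rtr (e (sw u).1 *m hdiff S j u)).
  apply: (etrans (mean_mix mixP A bX)); apply: eq_mean => u.
  by rewrite -/(sw u) sw_hdiff mulmxN /rtr raddfN raddfN.
have E2 : Aj j = \int[mu2]_u rtr (e (sw u).1 *m (jump j u *m jump j u)).
  apply: (etrans (mean_mix mixP A bD2)); apply: eq_mean => u.
  by rewrite -/(sw u) sw_jump NN.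
have E3 : BS S j = \int[mu2]_u rtr (e (sw u).1 *m (hdiff S j u *m hdiff S j u)).
  apply: (etrans (mean_mix mixP A bX2)); apply: eq_mean => u.
  by rewrite -/(sw u) sw_hdiff NN.
have besw : mxbmeas (fun u => e (sw u).1) by exact: (mxbmeas_mix A be).
have bX' : bmeas (fun u => rtr (e (sw u).1 *m hdiff S j u)).
  exact: (bmeas_rtr (mxbmeasM besw (mxbmeas_hdiff S j))).
have bX2' : bmeas (fun u => rtr (e (sw u).1 *m (hdiff S j u *m hdiff S j u))).
  exact: (bmeas_rtr (mxbmeasM besw (mxbmeasM (mxbmeas_hdiff S j) (mxbmeas_hdiff S j)))).
have bD2' : bmeas (fun u => rtr (e (sw u).1 *m (jump j u *m jump j u))).
  exact: (bmeas_rtr (mxbmeasM besw (mxbmeas_jump2 j))).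
apply: (mean_symmetrized_le bX bX' bD2 bD2' bX2 bX2' erefl E1 erefl E2 erefl E3) => u.
(* [G u.1 - G (sw u).1] unfolds to [jump j u], so the difference of the two exponents contributes
   the squared jump at [z]. *)
exact: (rtr_expmx_scale_sub_le theta s0 (hG u.1) (hG (sw u).1) (herm_hdiff S j u)).
Qed.

Let mgf := \int[mu]_z rtr (e z).
Let dmgf := \int[mu]_z rtr (e z *m G z).
Let W := \int[mu]_z rtr (expmx (psi%:C *: proxy z)).
Let L := ln (d%:R^-1 * W).

Let hermZproxy z : psi%:C *: proxy z \is hermsymmx.
Proof. exact: hermsymmxZ (proxy_herm z). Qed.

Let bW : bmeas (fun z => rtr (expmx (psi%:C *: proxy z))).
Proof. exact: (bmeas_rtr (mxbmeas_expmx hermZproxy (mxbmeasZ _ mxbmeas_proxy))). Qed.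

Let bmgf : bmeas (fun z => rtr (e z)).
Proof. exact: (bmeas_rtr be). Qed.

Let bdmgf : bmeas (fun z => rtr (e z *m G z)).
Proof. exact: (bmeas_rtr (mxbmeasM be bG)). Qed.

Let mean_rtrG A : \int[mu]_z rtr (A *m G z) = 0.
Proof. by rewrite -(rtr_mean_mx mu A bG) G0 mulmx0 /rtr mxtrace0. Qed.

(** Since [tr e^A >= d + tr A] and [G] has mean zero, the linear term disappears on average. *)
Lemma mgf_ge : d%:R <= mgf.
Proof.
have bl : bmeas (fun z => d%:R + rtr (theta%:C%:M *m G z)).
  exact: (bmeasD (bmeas_cst _) (bmeas_rtr (mxbmeasM (mxbmeas_cst _) bG))).
have := le_mean mu bl bmgf; rewrite -/mgf.
rewrite (meanD mu (bmeas_cst _) (bmeas_rtr (mxbmeasM (mxbmeas_cst _) bG))).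
rewrite mean_rtrG mean_cst addr0; apply => z.
by rewrite mul_scalar_mx; exact: rtr_expmx_ge.
Qed.

Let rtr_proxy_ge0 z : 0 <= rtr (proxy z).
Proof.
rewrite -[proxy z]mul1mx rtr_proxy mulr_ge0 ?invr_ge0// sumr_ge0// => j _.
by apply: Rintegral_ge0 => y _; rewrite mul1mx; exact: rtr_sqr_ge0 (herm_jump j (z, y)).
Qed.

Lemma proxy_mgf_ge : d%:R <= W.
Proof.
rewrite -(mean_cst mu d%:R); apply: (le_mean mu (bmeas_cst _) bW) => z.
apply: le_trans (rtr_expmx_ge (hermZproxy z)).
by rewrite rtrZ lerDl mulr_ge0// ltW.
Qed.

(* Klein's inequality with the shift [L], for which the right-hand side has
   nonpositive mean. *)
Lemma mean_proxy_mix_le S :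
  \int[mu2]_u rtr (e u.1 *m proxy (mix S u.1 u.2)) <= (theta * dmgf + L * mgf) / psi.
Proof.
have d0 : 0 < d%:R :> R by rewrite ltr0n.
have W0 : 0 < W := lt_le_trans d0 proxy_mgf_ge.
(* The shift [L] is the one for which [e^(-L) W = d]; the averaged right-hand side of Klein's
   inequality is then [d - mgf], nonpositive by [mgf_ge]. *)
have expL : expR (- L) * W = d%:R.
  rewrite expRN lnK; last by rewrite posrE mulr_gt0// invr_gt0.
  by rewrite invfM invrK -mulrA mulVf ?mulr1// gt_eqF.
have ba : bmeas (fun u : E * E => rtr (e u.1 *m proxy (mix S u.1 u.2))).
  exact: (brtr (mxbmeas_mix S mxbmeas_proxy)).
have bw : bmeas (fun u : E * E => rtr (expmx (psi%:C *: proxy (mix S u.1 u.2)))).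
  exact: (bmeas_comp (measurable_mix mixP S) bW).
(* A hybrid of two independent points has the law [mu], so this mean does not depend on [S]. *)
have Ew : \int[mu2]_u rtr (expmx (psi%:C *: proxy (mix S u.1 u.2))) = W.
  rewrite /W -(mean_fst mu mu bW).
  exact/esym/(mean_mix mixP S (bmeas_comp measurable_fst bW)).
have klein u : psi * rtr (e u.1 *m proxy (mix S u.1 u.2)) -
    theta * rtr (e u.1 *m G u.1) - L * rtr (e u.1) <=
    expR (- L) * rtr (expmx (psi%:C *: proxy (mix S u.1 u.2))) - rtr (e u.1).
  have := rtr_klein L (hermZG u.1) (hermZproxy (mix S u.1 u.2)).
  rewrite -/(e u.1); move: (e u.1) (expmx _) => eu ep.
  by rewrite -!scalemxAr !rtrZ.
have := mean_klein_le ba (bmeas_comp measurable_fst bdmgf)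
  (bmeas_comp measurable_fst bmgf) bw erefl (mean_fst mu mu bdmgf)
  (mean_fst mu mu bmgf) Ew klein.
rewrite expL ler_pdivlMr// => H; rewrite mulrC; apply: (le_trans H).
by have := mgf_ge; rewrite /mgf /dmgf; lra.
Qed.

Let rtr_e_jump_ge0 j z u : 0 <= rtr (e z *m (jump j u *m jump j u)).
Proof. exact: rtr_expmx_sqr_ge0 (hermZG z) (herm_jump j u). Qed.

Let rtr_e_proxy z x : rtr (e z *m proxy x) =
  2^-1 * \sum_j \int[mu]_y rtr (e z *m (jump j (x, y) *m jump j (x, y))).
Proof. exact: rtr_proxy. Qed.

(** For the full set the hybrid is [z] itself, and by Fubini the sum of the squared jumps is twice
    the trace against the proxy at [z]. *)
Lemma sum_jump_le : \sum_j Aj j <= 2 * ((theta * dmgf + L * mgf) / psi).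
Proof.
have := mean_proxy_mix_le [set: 'I_n]%SET.
rewrite (@eq_mean _ _ _ mu2 _ (fun u => rtr (e u.1 *m proxy u.1))); last first.
  by move=> u; rewrite (mixT mixP).
rewrite (mean_fst mu mu (bmeas_rtr (mxbmeasM be mxbmeas_proxy))).
suff -> : \int[mu]_z rtr (e z *m proxy z) = 2^-1 * \sum_j Aj j by lra.
under eq_mean do rewrite rtr_e_proxy.
have bj j : bmeas (fun z => \int[mu]_y rtr (e z *m (jump j (z, y) *m jump j (z, y)))).
  exact: (bmeas_mean mu (brtr (mxbmeas_jump2 j))).
rewrite (meanZ mu _ (bmeas_sum _ _ bj)) (mean_sum mu _ _ bj).
congr (_ * _); apply: eq_bigr => j _.
exact: (mean_prod mu mu (brtr (mxbmeas_jump2 j))).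
Qed.

(** The point [w] may be replaced by [mix S w y], which has the same law. Taking for [S] the
    complement of [j] gives the [j]-th coordinate of [w] a fresh independent name. *)
Lemma mean_resample S (f : E * E -> R) : bmeas f ->
  \int[mu2]_u f u = \int[mu]_z \int[mu]_w \int[mu]_y f (z, mix S w y).
Proof.
move=> bf; rewrite -(mean_prod mu mu bf); apply: eq_mean => z.
have bz := bmeas_section z bf.
rewrite -(mean_fst mu mu bz) (mean_mix mixP S (bmeas_comp measurable_fst bz)).
exact/esym/(mean_prod mu mu (bmeas_comp (measurable_mix mixP S) bz)).
Qed.

(** For [j] in [S] the [j]-th coordinate of [w] enters [hdiff S j] only through the second hybrid.
    Once it is drawn afresh from [y], the increment is exactly the jump at [x = mix S z w]. The
    terms of the proxy at [x] with [j] outside [S] are nonnegative and can be added. *)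
Lemma sum_hdiff_le (S : {set 'I_n}) :
  \sum_(j in S) BS S j <= 2 * ((theta * dmgf + L * mgf) / psi).
Proof.
have := mean_proxy_mix_le S.
set q := fun j (u : E * E) =>
  \int[mu]_y rtr (e u.1 *m (jump j (mix S u.1 u.2, y) *m jump j (mix S u.1 u.2, y))).
have mq : measurable_fun setT
    (fun v : (E * E) * E => (mix S v.1.1 v.1.2, v.2)).
  exact: (measurable_fun_pair (measurableT_comp (measurable_mix mixP S) measurable_fst)
    measurable_snd).
have bq j : bmeas (q j).
  have b1 : mxbmeas (fun v : (E * E) * E => e v.1.1).
    move=> i k; have [c1 c2] := be i k.
    split; [exact: (bmeas_comp (measurableT_comp measurable_fst measurable_fst) c1)|
            exact: (bmeas_comp (measurableT_comp measurable_fst measurable_fst) c2)].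
  have b2 : mxbmeas (fun v : (E * E) * E => jump j (mix S v.1.1 v.1.2, v.2) *m
      jump j (mix S v.1.1 v.1.2, v.2)).
    move=> i k; have [c1 c2] := mxbmeas_jump2 j i k.
    by split; [exact: (bmeas_comp mq c1)|exact: (bmeas_comp mq c2)].
  exact: (bmeas_mean mu (bmeas_rtr (mxbmeasM b1 b2))).
have q0 j u : 0 <= q j u by apply: Rintegral_ge0 => y _; exact: rtr_e_jump_ge0.
have Bq j : j \in S -> BS S j = \int[mu2]_u q j u.
  move=> jS.
  apply: (etrans (mean_resample (~: [set j])%SET
    (brtr (mxbmeasM (mxbmeas_hdiff S j) (mxbmeas_hdiff S j))))).
  apply: etrans (mean_prod mu mu (bq j)).
  apply: eq_mean => z; apply: eq_mean => w; apply: eq_mean => y.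
  by rewrite /hdiff /h /= (mix_freshl mixP)// (mix_freshr mixP).
rewrite (@eq_mean _ _ _ mu2 _ (fun u => 2^-1 * \sum_j q j u)); last first.
  by move=> u; exact: rtr_e_proxy.
rewrite (meanZ mu2 _ (bmeas_sum _ _ bq)) (mean_sum mu2 _ _ bq) => le.
suff : \sum_(j in S) BS S j <= \sum_j \int[mu2]_u q j u by lra.
rewrite (eq_bigr _ Bq) [leRHS](bigID (mem S))/= lerDl sumr_ge0// => j _.
by apply: Rintegral_ge0 => u _; exact: q0.
Qed.

(** By independence and centring, [tr (e^(theta G(z)) G(w))] has mean zero. Subtracting it replaces
    [G(z)] by [G(z) - G(w)], which telescopes from the full set down to the empty one. *)
Lemma dmgf_chain (s : {perm 'I_n}) :
  dmgf = \sum_(k < n) xS (chain s k.+1) (s k).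
Proof.
have bx (k : 'I_n) := brtr (mxbmeas_hdiff (chain s k.+1) (s k)).
rewrite /xS -(mean_sum mu2 _ _ bx).
have bG2 : mxbmeas (fun u : E * E => G u.2).
  move=> i j; have [b1 b2] := bG i j.
  by split; [exact: (bmeas_comp measurable_snd b1)|exact: (bmeas_comp measurable_snd b2)].
have E0 : \int[mu2]_u rtr (e u.1 *m G u.2) = 0.
  apply: (etrans (esym (mean_prod mu mu (brtr bG2)))).
  apply: etrans (mean_cst mu 0).
  by apply: eq_mean => z; exact: (mean_rtrG (e z)).
transitivity (\int[mu2]_u (rtr (e u.1 *m G u.1) - rtr (e u.1 *m G u.2))).
  apply: etrans (esym (meanB mu2 (brtr (mxbmeas_fst bG)) (brtr bG2))).
  by rewrite E0 subr0; exact/esym/(mean_fst mu mu bdmgf).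
apply: eq_mean => u; rewrite -rtrB -mulmxBr -rtr_sum -mulmx_sumr.
congr (rtr (_ *m _)).
transitivity (\sum_(k < n) (h (chain s k.+1) u - h (chain s k) u)); last first.
  by apply: eq_bigr => k _; rewrite /hdiff -chain_pred.
rewrite -(big_mkord xpredT (fun k => h (chain s k.+1) u - h (chain s k) u)).
by rewrite telescope_sumr// chain_full chain0 /h (mixT mixP) (mix0 mixP).
Qed.

(** The bound [K] contains [dmgf] with coefficient [theta / psi]; moving that part to the left
    produces the factor [1 - 2 theta^2 / psi]. *)
Lemma dmgf_le : dmgf * (1 - 2 * theta ^+ 2 / psi) <= 2 * theta / psi * (L * mgf).
Proof.
have := @chain_inequality R n Aj BS xS dmgf _ theta theta_gt0
  (fun S j s => @hdiff_increment S j s) dmgf_chain sum_jump_le sum_hdiff_le.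
set K := _ / psi; have -> : K = theta / psi * dmgf + (L * mgf) / psi.
  by rewrite /K; field; rewrite gt_eqF.
have -> : 2 * theta ^+ 2 / psi = 2 * theta * (theta / psi) by field; rewrite gt_eqF.
have -> : 2 * theta / psi * (L * mgf) = 2 * theta * ((L * mgf) / psi).
  by field; rewrite gt_eqF.
lra.
Qed.

End fixed_parameter.
End core.

(** On [[0, t]] the factor [1 - 2 b^2 / psi] is smallest at [b = t]. Freezing it there leaves the
    linear rate [c b], whose integral [c t^2 / 2] is the stated bound. The chord hypothesis on [g]
    takes the place of [m' = g]. *)
Lemma log_growth_le {R : realType} (m g : R -> R) (psi L t d : R) :
  0 < psi -> 0 <= L -> 0 < d -> m 0 = d -> (forall s, 0 < m s) ->
  (forall a b, m b - m a <= (b - a) * g b) ->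
  (forall b, 0 < b -> g b * (1 - 2 * b ^+ 2 / psi) <= 2 * b / psi * (L * m b)) ->
  0 <= t -> 2 * t ^+ 2 / psi < 1 ->
  ln (d^-1 * m t) <= (t ^+ 2 / psi) / (1 - 2 * t ^+ 2 / psi) * L.
Proof.
move=> psi0 L0 d0 mE m0 chord gle t0 t1.
pose r := 1 - 2 * t ^+ 2 / psi; have r0 : 0 < r by rewrite subr_gt0.
pose c := 2 * L / (psi * r).
have c0 : 0 <= c by rewrite /c divr_ge0 ?mulr_ge0// ltW// mulr_gt0.
have inc a b : 0 <= a -> a <= b -> b <= t -> m b - m a <= (b - a) * (c * b * m b).
  move=> a0 ab bt; have [b0|b0] := ltP 0 b; last first.
    have -> : a = b by apply/eqP; rewrite eq_le ab (le_trans b0 a0).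
    by rewrite !subrr mul0r.
  apply: (le_trans (chord a b)); rewrite ler_wpM2l ?subr_ge0//.
  have b2t : b ^+ 2 <= t ^+ 2 by rewrite ler_sqr ?nnegrE// ltW.
  pose r' := 1 - 2 * b ^+ 2 / psi.
  have rr : r <= r' by rewrite /r /r' lerB// ler_pM2r ?invr_gt0// ler_wpM2l.
  have r'0 : 0 < r' by exact: lt_le_trans rr.
  have -> : c * b * m b = 2 * b / psi * (L * m b) / r.
    by rewrite /c; field; rewrite !gt_eqF.
  apply: (@le_trans _ _ (2 * b / psi * (L * m b) / r')).
    by rewrite ler_pdivlMr//; exact: gle.
  rewrite ler_wpM2l ?lef_pV2 ?posrE//.
  by rewrite mulr_ge0 ?mulr_ge0 ?invr_ge0 ?(ltW (m0 _))// ltW.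
have := ln_increment_le c0 t0 m0 inc; rewrite mE lnM ?posrE ?invr_gt0// lnV ?posrE//.
rewrite (addrC (- _)).
have -> : c * t ^+ 2 / 2 = t ^+ 2 / psi / r * L.
  by rewrite /c; field; rewrite !gt_eqF.
by [].
Qed.

(** * The logarithmic bound for parameters of either sign *)

Section log_mgf.
Context {R : realType} {n d : nat} {dE : measure_display} {E : measurableType dE}.
Variables (mu : probability E R) (mix : {set 'I_n} -> E -> E -> E) (psi : R).
Hypotheses (mixP : mixing mu mix) (psi_gt0 : 0 < psi) (d_gt0 : (0 < d)%N).
Implicit Type G : E -> 'M[R[i]]_d.

Local Notation mgf G t := (\int[mu]_z rtr (expmx (t%:C *: G z))).

(** Convexity of the trace moment in its parameter, from [rtr_klein] with zero shift for the
    exponents [b G] and [a G]. *)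
Lemma ler_dmgf_chord G a b : (forall z, G z \is hermsymmx) -> mxbmeas G ->
  mgf G b - mgf G a <= (b - a) * \int[mu]_z rtr (expmx (b%:C *: G z) *m G z).
Proof.
move=> hG bG.
have hZ t z : t%:C *: G z \is hermsymmx by exact: hermsymmxZ.
have be t : mxbmeas (fun z => expmx (t%:C *: G z)).
  exact: (mxbmeas_expmx (hZ t) (mxbmeasZ _ bG)).
have beG : bmeas (fun z => rtr (expmx (b%:C *: G z) *m G z)).
  exact: (bmeas_rtr (mxbmeasM (be b) bG)).
rewrite -(meanB mu (bmeas_rtr (be b)) (bmeas_rtr (be a))) -(meanZ mu _ beG).
apply: (le_mean mu (bmeasB (bmeas_rtr (be b)) (bmeas_rtr (be a))) (bmeasZ _ beG)) => z.
have := rtr_klein 0 (hZ b z) (hZ a z).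
rewrite oppr0 expR0 mul1r mul0r subr0.
move: (expmx _) (expmx _) => eb ea.
by rewrite -!scalemxAr !rtrZ; lra.
Qed.

Lemma log_mgf_le_pos G t : (forall z, G z \is hermsymmx) -> mxbmeas G ->
  mean_mx mu G = 0 -> 0 <= t -> 2 * t ^+ 2 / psi < 1 ->
  ln (d%:R^-1 * mgf G t) <= (t ^+ 2 / psi) / (1 - 2 * t ^+ 2 / psi) *
    ln (d%:R^-1 * \int[mu]_z rtr (expmx (psi%:C *: proxy mu mix G z))).
Proof.
move=> hG bG G0 t0 t1.
have d0 : 0 < d%:R :> R by rewrite ltr0n.
have md s : d%:R <= mgf G s := mgf_ge hG bG G0 s.
have m0 s : 0 < mgf G s := lt_le_trans d0 (md s).
have mE : mgf G 0 = d%:R.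
  apply: etrans (mean_cst mu d%:R); apply: eq_mean => z.
  by rewrite scale0r expmx0 /rtr mxtrace1 (_ : d%:R = (d%:R)%:C) //= rmorph_nat.
have L0 : 0 <= ln (d%:R^-1 * \int[mu]_z rtr (expmx (psi%:C *: proxy mu mix G z))).
  apply: ln_ge0; rewrite mulrC ler_pdivlMr// mul1r.
  exact: (proxy_mgf_ge mixP hG bG psi_gt0).
exact: (@log_growth_le R (fun s => mgf G s)
  (fun s => \int[mu]_z rtr (expmx (s%:C *: G z) *m G z)) psi _ t d%:R psi_gt0 L0 d0 mE m0
  (fun a b => ler_dmgf_chord a b hG bG)
  (fun b b0 => dmgf_le mixP hG bG G0 b0 psi_gt0 d_gt0) t0 t1).
Qed.

Let log_mgf_le_eq G t X W : (forall z, G z \is hermsymmx) -> mxbmeas G ->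
  mean_mx mu G = 0 -> 0 <= t -> 2 * t ^+ 2 / psi < 1 ->
  mgf G t = X -> \int[mu]_z rtr (expmx (psi%:C *: proxy mu mix G z)) = W ->
  ln (d%:R^-1 * X) <= (t ^+ 2 / psi) / (1 - 2 * t ^+ 2 / psi) * ln (d%:R^-1 * W).
Proof. by move=> hG bG G0 t0 t1 <- <-; exact: log_mgf_le_pos. Qed.

(** A negative parameter is handled by passing to [- G]: the proxy is quadratic in [G], so it is
    unchanged, and [(- t) (- G) = t G]. *)
Lemma log_mgf_le G t : (forall z, G z \is hermsymmx) -> mxbmeas G ->
  mean_mx mu G = 0 -> 2 * t ^+ 2 / psi < 1 ->
  ln (d%:R^-1 * mgf G t) <= (t ^+ 2 / psi) / (1 - 2 * t ^+ 2 / psi) *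
    ln (d%:R^-1 * \int[mu]_z rtr (expmx (psi%:C *: proxy mu mix G z))).
Proof.
move=> hG bG G0 t1; have [t0|t0] := leP 0 t; first exact: log_mgf_le_pos.
pose N z := - G z.
have hN z : N z \is hermsymmx.
  by apply/hermsymmxP; rewrite raddfN map_mxN; congr (- _); exact/hermsymmxP.
have bN : mxbmeas N by have := mxbmeasZ (-1) bG; under eq_fun do rewrite scaleN1r.
have N0 : mean_mx mu N = 0.
  apply/matrixP => i j; have /matrixP/(_ i j) := G0; rewrite !mxE => -[re im].
  have [b1 b2] := bG i j.
  congr (_ +i* _).
    transitivity (- \int[mu]_z complex.Re (G z i j)); last by rewrite re oppr0.
    rewrite -mulN1r -(meanZ mu _ b1); apply: eq_mean => z.
    by rewrite mxE raddfN mulN1r.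
  transitivity (- \int[mu]_z complex.Im (G z i j)); last by rewrite im oppr0.
  rewrite -mulN1r -(meanZ mu _ b2); apply: eq_mean => z.
  by rewrite mxE raddfN mulN1r.
have jumpN j u : jump mix N j u = - jump mix G j u by rewrite /jump /N opprD.
have jj z : (fun j y => jump mix N j (z, y) *m jump mix N j (z, y)) =
    (fun j y => jump mix G j (z, y) *m jump mix G j (z, y)).
  by apply/funext => j; apply/funext => y; rewrite jumpN mulNmx mulmxN opprK.
have pN : proxy mu mix N = proxy mu mix G.
  apply/funext => z.
  exact: (congr1 (fun F : 'I_n -> E -> 'M[R[i]]_d =>
    (2^-1)%:C *: \sum_j mean_mx mu (F j)) (jj z)).
have eN : (fun z => rtr (expmx ((- t)%:C *: N z))) = (fun z => rtr (expmx (t%:C *: G z))).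
  by apply/funext => z; rewrite /N rmorphN scaleNr scalerN opprK.
have eX := congr1 (fun f : E -> R => \int[mu]_z f z) eN.
have eW := congr1 (fun F : E -> 'M[R[i]]_d => \int[mu]_z rtr (expmx (psi%:C *: F z))) pN.
rewrite -(sqrrN t); apply: (log_mgf_le_eq hN bN N0 _ _ eX eW); last by rewrite sqrrN.
by rewrite oppr_ge0 ltW.
Qed.

End log_mgf.

(** * Borel sets of a Polish product are generated by boxes *)

Section boxes.
Context {n : nat} {T : 'I_n -> ptopologicalType}.
Local Notation X := (prod_topology T).
Local Notation E := (borelType X).

Definition box (A : forall i, set (T i)) : set X := [set z | forall i, A i (z i)].

(** The filter generated by the open boxes around [x] converges to [x]: a neighbourhood coming from
    one projection contains a box constrained in that coordinate alone. *)
Lemma nbhs_box (x : X) (U : set X) : nbhs x U ->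
  exists A, [/\ forall i, open (A i), box A x & box A `<=` U].
Proof.
pose F : set_system X :=
  filter_from [set A : forall i, set (T i) | forall i, open (A i) /\ A i (x i)] box.
have FF : Filter F.
  apply: filter_from_filter.
    by exists (fun=> setT) => i; split; [exact: openT|].
  move=> A B oA oB; exists (fun i => A i `&` B i).
    move=> i; have [? ?] := oA i; have [? ?] := oB i.
    by split; [exact: openI|split].
  by move=> z zAB; split => i; have [] := zAB i.
suff /[apply] : F --> (x : X).
  by move=> [A oA AU]; exists A; split => // i; have [] := oA i.
apply/(cvg_sup _ x) => i U0 /=.
rewrite (@nbhsE (initial_topology (fun f : X => f i))) => -[_ [[B oB <-] Bx BU]].
pose A := @dfwith _ (fun k => set (T k)) (fun=> setT) i B.
rewrite nbhs_filterE; exists A.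
  by move=> j; rewrite /A; case: dfwithP => [//|k _]; split; [exact: openT|].
by move=> z zA; apply: BU; have := zA i; rewrite /A dfwithin.
Qed.

Lemma proj_box_continuous (i : 'I_n) : continuous (fun z : X => z i).
Proof. exact: (@proj_continuous _ T i). Qed.

Lemma open_box A : (forall i, open (A i)) -> open (box A).
Proof.
move=> oA; rewrite openE => z zA; apply: (@filter_forall _ 'I_n
  (fun i (x : X) => A i (x i)) (nbhs z) _) => i.
apply: (proj_box_continuous (x := z)).
by apply: open_nbhs_nbhs; split; [exact: oA|exact: zA].
Qed.

Lemma measurable_proj_box (i : 'I_n) :
  measurable_fun setT ((fun z => z i) : E -> borelType (T i)).
Proof.
apply: (@measurability _ _ E (borelType (T i)) setT _ (@open (T i))) => //.
move=> _ [A oA <-]; rewrite setTI; apply: sub_sigma_algebra.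
by move/continuousP : (@proj_box_continuous i); exact.
Qed.

Lemma measurable_box (A : forall i, set (T i)) :
  (forall i, measurable (A i : set (borelType (T i)))) -> measurable (box A : set E).
Proof.
move=> mA; have -> : box A = \bigcap_(i in setT) ((fun z : X => z i) @^-1` A i).
  by apply/seteqP; split => z zA i; [move=> _; exact: zA|exact: zA].
apply: (@fin_bigcap_measurable _ E); first exact: finite_finset.
move=> i _; rewrite -[X in measurable X]setTI.
exact: (measurable_proj_box measurableT (mA i)).
Qed.

Definition boxes : set (set E) :=
  [set B | exists2 A : forall i, set (T i),
     (forall i, measurable (A i : set (borelType (T i)))) & B = box A].

Lemma setI_closed_boxes : setI_closed boxes.
Proof.
move=> _ _ [A mA ->] [B mB ->]; exists (fun i => A i `&` B i).
  by move=> i; exact: measurableI.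
by apply/seteqP; split => [z [zA zB] i|z zAB]; [split|split => i; have [] := zAB i].
Qed.

Lemma boxesT : boxes setT.
Proof. by exists (fun=> setT) => [i|]; [exact: measurableT|apply/seteqP; split]. Qed.

Context {R : realType}.

(** Candidates are balls with centre in a countable dense set and radius [1 / (m+1)]. Whenever such
    a ball fits into some open box inside [U], one such box is chosen; these countably many boxes
    cover [U]. Thus Polishness of the product is enough, without bases in the factors. *)
Lemma open_countable_boxes (polishX : polish R X) (U : set X) : open U ->
  exists (D : set X) (A : X * nat -> forall i, set (T i)) (I : set (X * nat)),
    [/\ countable D, I `<=` D `*` setT, forall p i, open (A p i)
      & U = \bigcup_(p in I) box (A p)].
Proof.
move=> oU; have [[D [cD dD]] [dist [[dist0 dist00] distC tri nbhsP _]]] := polishX.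
pose bll (p : X * nat) := [set y | dist p.1 y < (p.2.+1%:R)^-1].
pose good (p : X * nat) (A : forall i, set (T i)) :=
  [/\ forall i, open (A i), bll p `<=` box A & box A `<=` U].
pose I := [set p : X * nat | D p.1 /\ exists A, good p A].
have exA p : exists A : forall i, set (T i),
    (forall i, open (A i)) /\ (I p -> good p A).
  have [[Dp [A gA]]|nI] := pselect (I p).
    by exists A; split=> [|_ //]; have [] := gA.
  by exists (fun=> setT); split => [i|//]; exact: openT.
have [A AP] := choice exA.
exists D, A, I; split => //.
- by move=> p [].
- by move=> p; have [] := AP p.
apply/seteqP; split => [x Ux|x [p Ip xA]]; last first.
  by have [_ /(_ Ip) [_ _]] := AP p; exact.
have /nbhs_box[B [oB xB BU]] : nbhs x U by apply: open_nbhs_nbhs.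
have /nbhsP[e e0 eB] : nbhs x (box B) by apply: open_nbhs_nbhs; split => //; exact: open_box.
(* The radius [1 / (r+1)] is below [e / 2], so if [q] is that close to [x], its ball of the same
   radius lies within distance [e] of [x], hence in [box B]. *)
pose r := Num.truncn (2 / e).
have re : (r.+1%:R)^-1 < e / 2 :> R.
  rewrite invf_plt ?posrE ?divr_gt0// invf_div; exact: truncnS_gt.
have r0 : 0 < (r.+1%:R)^-1 :> R by rewrite invr_gt0.
have nb : nbhs x [set y | dist x y < (r.+1%:R)^-1] by apply/nbhsP; exists (r.+1%:R)^-1.
have [q [/interior_subset xq Dq]] : ([set y | dist x y < (r.+1%:R)^-1]° `&` D) !=set0.
  by apply: dD; [exists x|exact: open_interior].
have Iq : I (q, r).
  split => //; exists B; split => // y /= qy; apply: eB => /=.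
  apply: le_lt_trans (tri x q y) _; have qx : dist x q < (r.+1%:R)^-1 := xq.
  have {}qy : dist q y < (r.+1%:R)^-1 := qy.
  by apply: lt_trans (ltrD qx qy) _; rewrite [ltRHS](splitr e) ltrD.
exists (q, r) => //.
by have [_ /(_ Iq) [_ + _]] := AP (q, r); apply; rewrite /bll/= distC.
Qed.

(** For general factors the Borel sets of the product may exceed those generated by boxes; the
    countable covers of open sets rule this out. Laws on the product are then determined by their
    values on boxes. *)
Lemma measurable_boxesE (polishX : polish R X) :
  (@measurable _ E) = <<s boxes >>.
Proof.
apply/seteqP; split; last first.
  apply: smallest_sub; first exact: sigma_algebra_measurable.
  by move=> _ [A mA ->]; exact: measurable_box.
apply: smallest_sub; first exact: smallest_sigma_algebra.
move=> U /(open_countable_boxes polishX)[D [A [I [cD ID oA ->]]]].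
have cI : countable I by apply: sub_countable (subset_card_le ID) _; exact: countableX.
have /countable_injP[f injf] := cI.
(* The countable union is reindexed by [nat]: as [f] is injective on [I], each [F k] is empty or a
   single box. *)
pose F k := \bigcup_(p in I `&` [set p | f p = k]) box (A p).
have -> : \bigcup_(p in I) box (A p) = \bigcup_k F k.
  apply/seteqP; split => [x [p Ip xp]|x [k _ [p [Ip _] xp]]]; last by exists p.
  by exists (f p) => //; exists p.
have [sB0 _ sBU] := @smallest_sigma_algebra E setT boxes.
apply: sBU => k.
have [[p [Ip fp]]|np] := pselect (exists p, I p /\ f p = k); last first.
  rewrite (_ : F k = set0); first exact: sB0.
  by apply/seteqP; split => // x [p [Ip fp] _]; apply: np; exists p.
rewrite (_ : F k = box (A p)).
  apply: sub_sigma_algebra; exists (A p) => // i.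
  exact: sub_sigma_algebra (oA p i).
apply/seteqP; split => [x [q [Iq fq] xq]|x xp]; last by exists p.
have -> : p = q.
  by apply: injf; [exact: mem_set|exact: mem_set|exact: etrans fp (esym fq)].
exact: xq.
Qed.

End boxes.

(** * Equality of laws, tested on boxes *)

Section laws.
Context {R : realType} {d1 d2 d3 : measure_display} {O1 : measurableType d1}
  {O2 : measurableType d2} {S : measurableType d3}.
Variables (P1 : probability O1 R) (P2 : probability O2 R).
Variables (h1 : O1 -> S) (h2 : O2 -> S).
Hypotheses (mh1 : measurable_fun setT h1) (mh2 : measurable_fun setT h2).

Lemma mean_same_law (f : S -> R) :
  (forall C, measurable C -> P1 (h1 @^-1` C) = P2 (h2 @^-1` C)) -> bmeas f ->
  \int[P1]_x f (h1 x) = \int[P2]_x f (h2 x).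
Proof.
move=> h12 bf; have mf : measurable_fun setT (EFin \o f).
  by apply/measurable_EFinP; case: bf.
rewrite /Rintegral; congr fine.
have := @integral_pushforward _ _ _ _ R _ mh1 P1 setT _ mf.
rewrite preimage_setT => /(_ (bmeas_integrable P1 (bmeas_comp mh1 bf)) measurableT) E1.
have := @integral_pushforward _ _ _ _ R _ mh2 P2 setT _ mf.
rewrite preimage_setT => /(_ (bmeas_integrable P2 (bmeas_comp mh2 bf)) measurableT) E2.
apply: (etrans (esym E1)); apply: etrans E2.
by apply: eq_measure_integral => C mC _; exact: h12.
Qed.

Lemma same_law_generated (G : set (set S)) :
  (@measurable _ S) = <<s G >> -> setI_closed G -> G setT ->
  (forall C, G C -> P1 (h1 @^-1` C) = P2 (h2 @^-1` C)) ->
  forall C, measurable C -> P1 (h1 @^-1` C) = P2 (h2 @^-1` C).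
Proof.
move=> mG GI GT h12 C mC.
pose X1 : {mfun O1 >-> S} := HB.pack h1 (isMeasurableFun.Build _ _ _ _ h1 mh1).
pose X2 : {mfun O2 >-> S} := HB.pack h2 (isMeasurableFun.Build _ _ _ _ h2 mh2).
apply: (@measure_unique _ R S G (fun=> setT) mG GI (fun=> GT) _
  (distribution P1 X1) (distribution P2 X2)) => //.
- by apply/seteqP; split => // x _; exists 0%N.
- by move=> k; apply: (le_lt_trans (probability_le1 _ measurableT)); rewrite ltry.
Qed.

End laws.

Section box_laws.
Context {R : realType} {n : nat} {T : 'I_n -> ptopologicalType}.
Local Notation E := (borelType (prod_topology T)).
Hypothesis polishX : polish R (prod_topology T).

Lemma measurable_fun_boxes d' (O : measurableType d') (f : O -> E) :
  (forall i, measurable_fun setT ((fun w => f w i) : O -> borelType (T i))) ->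
  measurable_fun setT f.
Proof.
move=> mf; apply: (@measurability _ _ O E setT f boxes); first exact: (measurable_boxesE polishX).
move=> _ [_ [A mA ->] <-]; rewrite setTI.
have -> : f @^-1` box A = \bigcap_(i in setT) ((fun w => f w i) @^-1` A i).
  by apply/seteqP; split => z zA i; [move=> _; exact: zA|exact: zA].
apply: fin_bigcap_measurable; first exact: finite_finset.
move=> i _; rewrite -[X in measurable X]setTI.
exact: (mf i measurableT _ (mA i)).
Qed.

Definition box_pairs : set (set (E * E)) :=
  [set C | exists A B, [/\ boxes A, boxes B & C = A `*` B]].

Lemma measurable_box_pairsE :
  (@measurable _ (E * E)%type) = <<s box_pairs >>.
Proof.
apply/seteqP; split; last first.
  apply: smallest_sub; first exact: sigma_algebra_measurable.
  move=> _ [_ [_ [[A mA ->] [B mB ->] ->]]].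
  by apply: measurableX; exact: measurable_box.
rewrite measurable_prod_measurableType.
apply: smallest_sub; first exact: smallest_sigma_algebra.
move=> _ [A mA [B mB <-]].
pose G := g_sigma_algebraType box_pairs.
have mfst : measurable_fun setT (fst : G -> E).
  apply: (@measurability _ _ G E setT _ boxes); first exact: (measurable_boxesE polishX).
  move=> _ [C bC <-]; rewrite setTI; apply: sub_sigma_algebra.
  by exists C, setT; split => //; [exact: boxesT|rewrite setXT].
have msnd : measurable_fun setT (snd : G -> E).
  apply: (@measurability _ _ G E setT _ boxes); first exact: (measurable_boxesE polishX).
  move=> _ [C bC <-]; rewrite setTI; apply: sub_sigma_algebra.
  by exists setT, C; split => //; [exact: boxesT|rewrite setTX].
have := @measurableI _ G _ _ (mfst measurableT _ mA) (msnd measurableT _ mB).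
by rewrite !setTI.
Qed.

Lemma setI_closed_box_pairs : setI_closed box_pairs.
Proof.
move=> _ _ [A [B [bA bB ->]]] [A' [B' [bA' bB' ->]]].
exists (A `&` A'), (B `&` B'); split; try exact: setI_closed_boxes.
by rewrite setXI.
Qed.

Lemma same_law_box_pairs d1 d2 (O1 : measurableType d1) (O2 : measurableType d2)
    (P1 : probability O1 R) (P2 : probability O2 R) (h1 : O1 -> E * E) (h2 : O2 -> E * E) :
  measurable_fun setT h1 -> measurable_fun setT h2 ->
  (forall A B : forall i, set (T i),
    (forall i, measurable (A i : set (borelType (T i)))) ->
    (forall i, measurable (B i : set (borelType (T i)))) ->
    P1 (h1 @^-1` (box A `*` box B)) = P2 (h2 @^-1` (box A `*` box B))) ->
  forall C, measurable C -> P1 (h1 @^-1` C) = P2 (h2 @^-1` C).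
Proof.
move=> mh1 mh2 h12.
apply: (@same_law_generated _ _ _ _ _ _ (E * E)%type P1 P2 h1 h2 mh1 mh2 box_pairs).
- exact: measurable_box_pairsE.
- exact: setI_closed_box_pairs.
- by exists setT, setT; split; [exact: boxesT|exact: boxesT|rewrite setXTT].
- by move=> _ [_ [_ [[A mA ->] [B mB ->] ->]]]; exact: h12.
Qed.

Definition splice (S : {set 'I_n}) (z w : E) : E :=
  (fun i => if i \in S then z i else w i) : prod_topology T.

Lemma measurable_splice S : measurable_fun setT (fun u : E * E => splice S u.1 u.2).
Proof.
apply: measurable_fun_boxes => i; rewrite /splice.
have mi := @measurable_proj_box n T i.
case: (i \in S).
  exact: (measurableT_comp mi measurable_fst).
exact: (measurableT_comp mi measurable_snd).
Qed.

Variables (mu : probability E R) (nu : forall i : 'I_n, set (T i) -> \bar R).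
Hypothesis mu_box : forall A : forall i, set (T i),
  (forall i, measurable (A i : set (borelType (T i)))) ->
  mu (box A) = (\prod_(i < n) nu (A i))%E.

(** On a product of two boxes the exchange only swaps, for each [i] outside [S], the factors
    [nu (A i)] and [nu (B i)] of a commutative product. Products of boxes are closed under
    intersection and generate, so the two laws agree. *)
Lemma mean_splice S (f : E * E -> R) : bmeas f ->
  \int[(mu \x mu)%E]_u f u =
  \int[(mu \x mu)%E]_u f (splice S u.1 u.2, splice S u.2 u.1).
Proof.
have m1 := measurable_splice S.
have m2 : measurable_fun setT (fun u : E * E => splice S u.2 u.1).
  exact: (measurableT_comp m1 (measurable_fun_pair measurable_snd measurable_fst)).
have m12 := measurable_fun_pair m1 m2.
have mid : measurable_fun setT (fun u : E * E => u) by exact: measurable_id.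
move=> bf; apply: (mean_same_law mid m12 _ bf).
apply: (same_law_box_pairs mid m12) => A B mA mB.
pose sw (A B : forall i, set (T i)) i := if i \in S then A i else B i.
have -> : (fun u : E * E => (splice S u.1 u.2, splice S u.2 u.1)) @^-1` (box A `*` box B) =
    box (sw A B) `*` box (sw B A).
  apply/seteqP; split => -[z w] [/= h1 h2].
    by split => i /=; have := h1 i; have := h2 i; rewrite /splice /sw; case: (i \in S).
  by split => i /=; have := h1 i; have := h2 i; rewrite /splice /sw; case: (i \in S).
have msw (A' B' : forall i, set (T i)) :
    (forall i, measurable (A' i : set (borelType (T i)))) ->
    (forall i, measurable (B' i : set (borelType (T i)))) ->
    forall i, measurable (sw A' B' i : set (borelType (T i))).
  by move=> mA' mB' i; rewrite /sw; case: (i \in S).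
rewrite [LHS]product_measure1E; [|exact: (measurable_box mA)|exact: (measurable_box mB)].
rewrite [RHS]product_measure1E; [|exact: (measurable_box (msw _ _ mA mB))|exact: (measurable_box (msw _ _ mB mA))].
apply: (etrans (congr2 mule (mu_box mA) (mu_box mB))).
apply: etrans (esym (congr2 mule (mu_box (msw _ _ mA mB)) (mu_box (msw _ _ mB mA)))).
rewrite -!big_split/=; apply: eq_bigr => i _; rewrite /sw.
by case: (i \in S) => //; rewrite muleC.
Qed.

Lemma mixing_splice : mixing mu splice.
Proof.
split.
- exact: measurable_splice.
- by move=> z w; apply: functional_extensionality_dep => i; rewrite /splice inE.
- by move=> z w; apply: functional_extensionality_dep => i; rewrite /splice inE.
- move=> S A z w; apply: functional_extensionality_dep => i; rewrite /splice inE.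
  by case: (i \in S); case: (i \in A).
- move=> S j z w y jS; apply: functional_extensionality_dep => i; rewrite /splice !inE.
  by have [->|] := eqVneq i j; rewrite ?jS.
- move=> S j z w y jS; apply: functional_extensionality_dep => i; rewrite /splice !inE.
  by have [->|] := eqVneq i j.
- exact: mean_splice.
Qed.

End box_laws.

(** * Integrals and conditional expectations up to null sets *)

Section ae_integral.
Context {R : realType} {dT : measure_display} {T : measurableType dT}.
Variable mu : {measure set T -> \bar R}.
Local Open Scope ereal_scope.

(** The integral of a nonnegative function is a supremum over the simple functions below it, which
    is monotone without measurability. *)
Lemma ge0_le_integral_nonmeasurable (f g : T -> \bar R) :
  (forall x, 0 <= f x) -> (forall x, f x <= g x) ->
  \int[mu]_x f x <= \int[mu]_x g x.
Proof.
move=> f0 fg; have g0 x : 0 <= g x := le_trans (f0 x) (fg x).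
rewrite !ge0_integralTE//; apply: ereal_sup_le => _ [h hf <-].
by exists h => // x; exact: le_trans (hf x) (fg x).
Qed.

(** Here [f] may fail to be measurable. It is squeezed between two measurable functions that equal
    [g] off the null set [N] and are 0, respectively [+oo], on it; both have the integral of [g]. *)
Let ge0_integral_ae (f g : T -> \bar R) : measurable_fun setT g ->
  (forall x, 0 <= f x) -> (forall x, 0 <= g x) ->
  {ae mu, forall x, f x = g x} -> \int[mu]_x f x = \int[mu]_x g x.
Proof.
move=> mg f0 g0 [N [mN N0 fgN]].
have fgE x : ~ N x -> f x = g x by move=> Nx; apply: contrapT => ?; exact/Nx/fgN.
pose b c x := if x \in N then c else g x.
have mb c : measurable_fun setT (b c).
  have mxN : measurable_fun setT (fun x => x \in N).
    apply: (measurable_fun_bool true); rewrite setTI.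
    by rewrite (_ : _ @^-1` _ = N)//; apply/seteqP; split => x; [exact: set_mem|exact: mem_set].
  exact: (measurable_fun_ifT mxN (measurable_cst c) mg).
have bg c : 0 <= c -> \int[mu]_x b c x = \int[mu]_x g x.
  move=> c0; apply: ge0_ae_eq_integral => //.
    by move=> x _; rewrite /b; case: ifP.
  exists N; split => // x /= h; apply: contrapT => Nx; apply: h => _.
  by rewrite /b memNset.
apply/eqP; rewrite eq_le; apply/andP; split.
  rewrite -(bg +oo)// ge0_le_integral_nonmeasurable// => x; rewrite /b.
  by case: ifPn => [_|/negP]; [exact: leey|rewrite in_setE => /fgE ->].
rewrite -(bg 0)// ge0_le_integral_nonmeasurable// => x; rewrite /b.
  by case: ifP.
by case: ifPn => [//|/negP]; rewrite in_setE => /fgE ->.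
Qed.

(** The random matrices of the theorem coincide with measurable functions of [Z] only almost surely;
    this carries their expectations over. *)
Lemma integral_ae (f g : T -> \bar R) : measurable_fun setT g ->
  {ae mu, forall x, f x = g x} -> \int[mu]_x f x = \int[mu]_x g x.
Proof.
move=> mg fg; rewrite [LHS]integralE [RHS]integralE; congr (_ - _).
  apply: ge0_integral_ae => //; first exact: measurable_funepos.
  by apply: filterS fg => x fgx; rewrite !funeposE fgx.
apply: ge0_integral_ae => //; first exact: measurable_funeneg.
by apply: filterS fg => x fgx; rewrite !funenegE fgx.
Qed.

End ae_integral.

Section conditional_expectation.
Context {R : realType} {dO : measure_display} {O : measurableType dO}
  {dE : measure_display} {E : measurableType dE}.
Variables (P : probability O R) (Z : O -> E).
Hypothesis mZ : measurable_fun setT Z.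

(** The difference [U = W - D(Z)] is measurable for the sigma-algebra of [Z], so the events [U >= 0]
    and [U < 0] have the form [Z^-1 B], where the integral of [U] vanishes. As [U] has constant sign
    on each, it is zero almost surely. *)
Lemma is_cond_expectation_ae (Y W : O -> R) (D : E -> R) :
  is_cond_expectation P (g_sigma_algebra_preimage Z) Y W -> bmeas D ->
  (forall B, measurable B ->
    (\int[P]_(w in Z @^-1` B) (Y w)%:E = \int[P]_(w in Z @^-1` B) (D (Z w))%:E)%E) ->
  {ae P, forall w, W w = D (Z w)}.
Proof.
move=> [GW iW WY] bD YD.
have iD : P.-integrable setT (EFin \o (D \o Z)) := bmeas_integrable P (bmeas_comp mZ bD).
pose U w := W w - D (Z w).
have iU : P.-integrable setT (EFin \o U).
  rewrite (_ : EFin \o U = (EFin \o W) \- (EFin \o (D \o Z)))%E.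
    exact: (integrableB measurableT iW iD).
  by apply/funext => w; rewrite /= EFinB.
have mU : measurable_fun setT (EFin \o U) := measurable_int _ iU.
pose O' := g_sigma_algebra_preimageType Z.
have mW' : measurable_fun setT (W : O' -> R) by move=> _ B mB; rewrite setTI; exact: GW.
have mD' : measurable_fun setT ((D \o Z) : O' -> R).
  move=> _ B mB; exists (D @^-1` B) => //.
  by rewrite -[X in measurable X]setTI; case: bD => mD _; exact: mD.
have mU' : measurable_fun setT (U : O' -> R) by exact: measurable_funB.
have ZU (C : set R) : measurable C -> exists2 B, measurable B & U @^-1` C = Z @^-1` B.
  move=> mC; have := mU' measurableT _ mC; rewrite setTI => -[B mB].
  by rewrite setTI => <-; exists B.
have U0 (C : set R) : measurable C -> (\int[P]_(w in U @^-1` C) (U w)%:E = 0)%E.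
  move=> mC; have [B mB UB] := ZU C mC; rewrite UB.
  have mZB : measurable (Z @^-1` B) by rewrite -[X in measurable X]setTI; exact: mZ.
  have iW' := integrableS measurableT mZB (@subsetT _ _) iW.
  have iD' := integrableS measurableT mZB (@subsetT _ _) iD.
  rewrite (integralB_EFin mZB iW' iD').
  rewrite [X in (X - _)%E](WY (Z @^-1` B)); last by exists B => //; rewrite setTI.
  rewrite YD// subee//; exact: integrable_fin_num.
have ae0 (C : set R) : measurable C ->
    (forall w, (U @^-1` C) w -> `|U w| = U w) \/ (forall w, (U @^-1` C) w -> `|U w| = - U w) ->
    {ae P, forall w, C (U w) -> U w = 0}.
  move=> mC sgn.
  have mUC : measurable (U @^-1` C).
    by have [B mB ->] := ZU C mC; rewrite -[X in measurable X]setTI; exact: mZ.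
  have mUC' : measurable_fun (U @^-1` C) (EFin \o U) by exact: measurable_funS mU.
  have : (\int[P]_(w in U @^-1` C) `|(EFin \o U) w| = 0)%E.
    have [sp|sn] := sgn.
      rewrite -(U0 C mC); apply: eq_integral => w /set_mem wC.
      by rewrite /= sp.
    rewrite -[RHS]oppe0 -(U0 C mC) -integralN/=; last first.
      exact: (integrable_add_def mUC (integrableS measurableT mUC (@subsetT _ _) iU)).
    by apply: eq_integral => w /set_mem wC; rewrite /= sn// EFinN.
  move=> /(ae_eq_integral_abs P mUC mUC'); apply: filterS => w wU wC.
  by have := wU wC => -[].
have h1 : {ae P, forall w, (`[0, +oo[%classic) (U w) -> U w = 0}.
  apply: ae0; first exact: measurable_itv.
  by left => w /=; rewrite in_itv/= andbT => /ger0_norm.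
have h2 : {ae P, forall w, (`]-oo, 0[%classic) (U w) -> U w = 0}.
  apply: ae0; first exact: measurable_itv.
  by right => w /=; rewrite in_itv/= => /ltr0_norm.
apply: filterS2 h1 h2 => w /=; rewrite !in_itv/= andbT => u1 u2.
apply/eqP; rewrite -subr_eq0; apply/eqP.
by have [/u1|/u2] := leP 0 (U w).
Qed.

End conditional_expectation.

(** * The joint law of [Z] and its copy with one coordinate replaced *)

Section joint_law.
Context {R : realType} {dO : measure_display} {Omega : measurableType dO}.
Variable P : probability Omega R.
Context {n : nat} {T : 'I_n -> ptopologicalType}.
Local Notation E := (borelType (prod_topology T)).
Variables (Z : Omega -> E) (Z' : forall j : 'I_n, Omega -> borelType (T j)).
Hypotheses (polishX : polish R (prod_topology T)) (mZ : measurable_fun setT Z).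
Hypothesis indepZ :
  mutually_independent P (fun (j : 'I_n) (w : Omega) => Z w j : borelType (T j)).
Hypothesis copiesZ : independent_copies P Z Z'.

Definition law_rv : {mfun Omega >-> E} :=
  HB.pack Z (isMeasurableFun.Build _ _ _ _ Z mZ).
Definition law : probability E R := distribution P law_rv.

Lemma law_box (A : forall i, set (T i)) :
  (forall i, measurable (A i : set (borelType (T i)))) ->
  law (box A) = (\prod_(i < n) P ((fun w => Z w i) @^-1` A i))%E.
Proof.
move=> mA; rewrite -(indepZ mA); congr (P _).
by apply/seteqP; split => w wA i; [move=> _; exact: wA|exact: wA].
Qed.

Lemma mixing_law : mixing law splice.
Proof.
exact: (@mixing_splice R n T polishX law
  (fun i (A : set (T i)) => P ((fun w => Z w i) @^-1` A)) law_box).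
Qed.

Lemma mean_law (f : E -> R) : bmeas f -> \int[P]_w f (Z w) = \int[law]_z f z.
Proof. by move=> bf; exact: (@mean_same_law _ _ _ _ _ _ _ P law Z id). Qed.

Variable j : 'I_n.
Local Notation rc := (replace_coord Z Z' j).

Let mproj (A : set (T j)) : measurable (A : set (borelType (T j))) ->
  measurable ((fun z => z j) @^-1` A : set E).
Proof.
by move=> mA; rewrite -[X in measurable X]setTI; exact: (measurable_proj_box measurableT mA).
Qed.

Lemma measurable_replace_coord : measurable_fun setT (rc : Omega -> E).
Proof.
apply: (measurable_fun_boxes polishX) => i; rewrite /replace_coord.
have [ji|ji] := eqVneq j i.
  case: i / ji; under eq_fun do rewrite dfwithin.
  by have [] := copiesZ j.
under eq_fun do rewrite dfwithout//.
exact: (measurableT_comp (@measurable_proj_box n T i) mZ).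
Qed.

(** On a product of boxes both events split into a condition on all coordinates of the first point,
    collected in [A'], and the condition [B j] on the fresh coordinate. Independence of [Z' j] and
    [Z] then gives the same product on each side. *)
Lemma joint_law C : measurable C ->
  P ((fun w => (Z w, rc w)) @^-1` C) =
  (law \x law)%E ((fun u : E * E => (u.1, splice (~: [set j])%SET u.1 u.2)) @^-1` C).
Proof.
have [mZ'j sameZ' indepZ'] := copiesZ j.
have mrc := measurable_fun_pair mZ measurable_replace_coord.
have msp := measurable_fun_pair (@measurable_fst _ _ E E)
  (measurable_splice polishX (~: [set j])%SET).
move: C; apply: (@same_law_box_pairs R n T polishX _ _ Omega (E * E)%type P
  (law \x law)%E _ _ mrc msp) => A B mA mB.
pose A' i := if i == j then A i else A i `&` B i.
have mA' i : measurable (A' i : set (borelType (T i))).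
  by rewrite /A'; case: (i == j) => //; exact: measurableI.
have -> : (fun w => (Z w, rc w)) @^-1` (box A `*` box B) =
    (Z' j @^-1` B j) `&` (Z @^-1` box A').
  apply/seteqP; split => w /=.
    move=> [wA wB]; split.
      by have := wB j; rewrite /replace_coord dfwithin.
    move=> i; rewrite /A'; have [ij|ij] := eqVneq i j; first exact: wA.
    split; first exact: wA.
    by have := wB i; rewrite /replace_coord dfwithout// eq_sym.
  move=> [wB wA]; split => i.
    by have := wA i; rewrite /A'; case: (i == j) => // -[].
  have := wA i; rewrite /A' /replace_coord.
  have [->|ij] := eqVneq i j; first by rewrite dfwithin.
  by rewrite dfwithout 1?eq_sym// => -[].
have -> : (fun u : E * E => (u.1, splice (~: [set j])%SET u.1 u.2)) @^-1`
    (box A `*` box B) = box A' `*` ((fun z : E => z j) @^-1` B j).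
  apply/seteqP; split => -[z y] /=.
    move=> [zA zB]; split.
      move=> i; rewrite /A'; have [ij|ij] := eqVneq i j; first exact: zA.
      by split; [exact: zA|have := zB i; rewrite /splice !inE ij].
    by have := zB j; rewrite /splice !inE eqxx.
  move=> [zA yB]; split => i.
    by have := zA i; rewrite /A'; case: (i == j) => // -[].
  have := zA i; rewrite /A' /splice !inE.
  by have [->|ij] := eqVneq i j => //= -[].
rewrite indepZ'//; last exact: measurable_box.
rewrite [RHS]product_measure1E; [|exact: (measurable_box mA')|exact: (mproj (mB j))].
by rewrite muleC sameZ'.
Qed.

Lemma mean_joint_law (f : E * E -> R) : bmeas f ->
  \int[P]_w f (Z w, rc w) =
  \int[law]_z \int[law]_y f (z, splice (~: [set j])%SET z y).
Proof.
have mrc := measurable_fun_pair mZ measurable_replace_coord.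
have msp := measurable_fun_pair (@measurable_fst _ _ E E)
  (measurable_splice polishX (~: [set j])%SET).
move=> bf; apply: (etrans (mean_same_law mrc msp joint_law bf)).
exact/esym/(mean_prod law law (bmeas_comp msp bf)).
Qed.

(** This transfers almost sure statements about [Z], such as the bound on [H], to the copy with
    coordinate [j] replaced. *)
Lemma replace_coord_law C : measurable C -> P (rc @^-1` C) = P (Z @^-1` C).
Proof.
move=> mC.
have m1 : measurable (rc @^-1` C).
  by rewrite -[X in measurable X]setTI; exact: measurable_replace_coord.
have m2 : measurable (Z @^-1` C) by rewrite -[X in measurable X]setTI; exact: mZ.
have bC : bmeas (\1_C : E -> R).
  split; first exact: measurable_indic.
  by exists 1 => z; rewrite indicE; case: (z \in C); rewrite ?normr1 ?normr0.
have h : \int[P]_w (\1_C (rc w) : R) = \int[P]_w (\1_C (Z w) : R).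
  rewrite (mean_law bC).
  apply: (etrans (mean_joint_law (bmeas_comp measurable_snd bC))).
  apply: (etrans _ (mean_fst law law bC)).
  apply: (etrans (mean_prod law law (bmeas_comp
    (measurable_splice polishX (~: [set j])%SET) bC))).
  exact/esym/(mean_mix mixing_law (~: [set j])%SET (bmeas_comp measurable_fst bC)).
have EC (f : Omega -> E) : measurable_fun setT f ->
    (\int[P]_w (\1_C (f w) : R))%:E = P (f @^-1` C).
  move=> mf; rewrite (EFin_mean P (bmeas_comp mf bC)).
  have := @integral_indic _ _ R P setT measurableT (f @^-1` C).
  by rewrite setIT; apply; rewrite -[X in measurable X]setTI; exact: mf.
apply: (etrans (esym (EC rc measurable_replace_coord))).
by apply: (etrans _ (EC Z mZ)); rewrite h.
Qed.

End joint_law.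

(** * From an almost sure norm bound to a function bounded everywhere *)

Section operator_norm.
Context {R : realType} {d : nat}.
Implicit Type A : 'M[R[i]]_d.

Definition nsq (z : R[i]) : R := complex.Re z ^+ 2 + complex.Im z ^+ 2.

Lemma nsqE z : (nsq z)%:C = `|z| ^+ 2.
Proof. exact: add_Re2_Im2. Qed.

Lemma nsq_ge0 z : 0 <= nsq z.
Proof. by rewrite addr_ge0 ?sqr_ge0. Qed.

(** The square of the Frobenius norm. As a finite sum over entries it is plainly measurable in [A],
    unlike a supremum over all unit vectors. *)
Definition frob A : R := \sum_i \sum_j nsq (A i j).

Lemma frob_entry A i j : nsq (A i j) <= frob A.
Proof.
have s0 k : 0 <= \sum_l nsq (A k l) by apply: sumr_ge0 => l _; exact: nsq_ge0.
rewrite /frob (bigD1 i)//= (bigD1 j)//= -addrA lerDl addr_ge0//.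
  by apply: sumr_ge0 => l _; exact: nsq_ge0.
by apply: sumr_ge0 => k _; exact: s0.
Qed.

Lemma frobB_le A B : frob A <= 2 * (frob (A - B) + frob B).
Proof.
rewrite /frob -big_split mulr_sumr; apply: ler_sum => i _ /=.
rewrite -big_split mulr_sumr; apply: ler_sum => j _ /=.
rewrite /nsq !mxE; case: (A i j) => a1 a2; case: (B i j) => b1 b2 /=.
have := sqr_ge0 (a1 - 2 * b1); have := sqr_ge0 (a2 - 2 * b2); nra.
Qed.

Lemma vnorm_sqr (x : 'cV[R[i]]_d) : vnorm x ^+ 2 = \sum_i nsq (x i 0).
Proof. by rewrite /vnorm sqr_sqrtr// sumr_ge0// => i _; exact: nsq_ge0. Qed.

(** [sup] is an upper bound only for a nonempty set that is bounded above. The row sums of the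
    moduli of the entries supply a bound. *)
Lemma has_sup_opnorm A : has_sup [set vnorm (A *m x) | x in [set x | vnorm x <= 1]].
Proof.
split.
  exists (vnorm (A *m 0)), 0 => //=.
  by rewrite /vnorm big1 ?sqrtr0// => i _; rewrite mxE /= expr0n/= addr0.
pose a i : R := complex.Re (\sum_k `|A i k|).
have aE i : (a i)%:C = \sum_k `|A i k|.
  by rewrite RRe_real//; apply: ger0_real; apply: sumr_ge0.
exists (Num.sqrt (\sum_i a i ^+ 2)) => _ [x /= x1 <-].
rewrite /vnorm ler_wsqrtr//; apply: ler_sum => i _.
have xk k : `|x k 0| <= 1.
  have : nsq (x k 0) <= 1.
    apply: (@le_trans _ _ (vnorm x ^+ 2)).
      rewrite vnorm_sqr (bigD1 k)//= lerDl sumr_ge0// => l _; exact: nsq_ge0.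
    by rewrite expr_le1// /vnorm sqrtr_ge0.
  by move=> h; rewrite -(@expr_le1 _ 2)// -nsqE lecR.
rewrite -/(nsq _) -lecR nsqE rmorphXn/= aE ler_sqr ?nnegrE ?sumr_ge0//.
rewrite mxE (le_trans (ler_norm_sum _ _ _))//; apply: ler_sum => k _.
by rewrite normrM ler_piMr.
Qed.

(** Each of the [d] columns is the image of a unit vector, so its squared norm is at most [M^2]. *)
Lemma frob_le_opnorm A M : opnorm A <= M -> frob A <= d%:R * M ^+ 2.
Proof.
move=> AM; rewrite /frob exchange_big/=.
rewrite -[d in d%:R](card_ord d) mulr_natl -sumr_const; apply: ler_sum => j _.
pose e : 'cV[R[i]]_d := delta_mx j 0.
have e1 : vnorm e <= 1.
  rewrite -(@expr_le1 _ 2)// ?vnorm_sqr ?/vnorm ?sqrtr_ge0//.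
  rewrite (bigD1 j)//= big1 ?addr0 => [|k kj]; rewrite /nsq mxE.
    by rewrite !eqxx/= expr1n expr0n/= addr0.
  by rewrite (negbTE kj)/= expr0n/= addr0.
have Ae : vnorm (A *m e) <= M.
  apply: le_trans AM; apply: (sup_upper_bound (has_sup_opnorm A)).
  by exists e.
have <- : vnorm (A *m e) ^+ 2 = \sum_i nsq (A i j).
  by rewrite vnorm_sqr; apply: eq_bigr => i _; rewrite -colE mxE.
by rewrite lerXn2r// ?nnegrE; rewrite ?(le_trans _ Ae)// /vnorm sqrtr_ge0.
Qed.

End operator_norm.

Section truncation.
Context {R : realType} {d : nat} {dE : measure_display} {E : measurableType dE}.
Variables (H : E -> 'M[R[i]]_d) (K : R).
Hypothesis mH : measurable_mx H.

(** [Z] stays in this set almost surely, so setting [H] to zero outside it is invisible to the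
    expectations. *)
Definition tame : set E := [set z | frob (H z) <= K].

Definition truncated (z : E) : 'M[R[i]]_d := (\1_tame z : R)%:C *: H z.

Lemma measurable_tame : measurable tame.
Proof.
have mf : measurable_fun setT (fun z => frob (H z)).
  apply: measurable_sum => i; apply: measurable_sum => j; have [m1 m2] := mH i j.
  by apply: measurable_funD; exact: measurable_funX.
rewrite (_ : tame = (fun z => frob (H z)) @^-1` `]-oo, K]%classic).
  by rewrite -[X in measurable X]setTI; apply: mf => //; exact: measurable_itv.
by apply/seteqP; split => z /=; rewrite in_itv.
Qed.

Lemma truncatedE z : tame z -> truncated z = H z.
Proof. by move=> tz; rewrite /truncated indicE mem_set// scale1r. Qed.

Lemma truncated_herm z : H z \is hermsymmx -> truncated z \is hermsymmx.
Proof. exact: hermsymmxZ. Qed.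

Lemma mxbmeas_truncated : mxbmeas truncated.
Proof.
have tame_indic z : `|\1_tame z : R| <= 1.
  by rewrite indicE; case: (z \in tame); rewrite ?normr1 ?normr0.
have bound (c : R) z i j : (c ^+ 2 <= nsq (H z i j)) -> `|(\1_tame z : R) * c| <= 1 + `|K|.
  move=> cH; rewrite indicE; have [/set_mem zt|_] := boolP (z \in tame); last first.
    by rewrite mul0r normr0 addr_ge0.
  rewrite mul1r; have : `|c| ^+ 2 <= `|K|.
    rewrite -normrX ger0_norm ?sqr_ge0//.
    exact: le_trans cH (le_trans (frob_entry (H z) i j) (le_trans zt (ler_norm _))).
  by have := sqr_ge0 (`|c| - 1); nra.
have mi : measurable_fun setT (\1_tame : E -> R) by exact/measurable_indic/measurable_tame.
move=> i j; have [m1 m2] := mH i j; split.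
  rewrite (_ : (fun z => _) = fun z => (\1_tame z : R) * complex.Re (H z i j)).
    split; first exact: measurable_funM.
    by exists (1 + `|K|) => z; apply: (bound _ z i j); rewrite /nsq lerDl sqr_ge0.
  by apply/funext => z; rewrite mxE; case: (H z i j) => a b /=; rewrite mul0r subr0.
rewrite (_ : (fun z => _) = fun z => (\1_tame z : R) * complex.Im (H z i j)).
  split; first exact: measurable_funM.
  by exists (1 + `|K|) => z; apply: (bound _ z i j); rewrite /nsq lerDr sqr_ge0.
by apply/funext => z; rewrite mxE; case: (H z i j) => a b /=; rewrite mul0r addr0.
Qed.

End truncation.

Lemma ntrace_Re {R : realType} {d : nat} (A : 'M[R[i]]_d) :
  complex.Re (ntrace A) = d%:R^-1 * rtr A.
Proof.
rewrite /ntrace /rtr (_ : (d%:R : R[i])^-1 = ((d%:R : R)^-1)%:C); last first.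
  by rewrite fmorphV rmorph_nat.
by case: (\tr A) => a b /=; rewrite mul0r subr0.
Qed.

(** * Transfer of the random matrices to functions on the law of [Z] *)

Section reduction.
Context {R : realType} {dO : measure_display} {Omega : measurableType dO}.
Variable P : probability Omega R.
Context {n d : nat} {T : 'I_n -> ptopologicalType}.
Local Notation E := (borelType (prod_topology T)).
Variables (Z : Omega -> E) (Z' : forall j : 'I_n, Omega -> borelType (T j)).
Variables (H : E -> 'M[R[i]]_d) (K : R).
Hypotheses (polishX : polish R (prod_topology T)) (mZ : measurable_fun setT Z).
Hypothesis indepZ :
  mutually_independent P (fun (j : 'I_n) (w : Omega) => Z w j : borelType (T j)).
Hypothesis copiesZ : independent_copies P Z Z'.
Hypotheses (hH : forall z, H z \is hermsymmx) (mH : measurable_mx H).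
Hypothesis tameZ : {ae P, forall w, tame H K (Z w)}.

Local Notation mu := (law P mZ).
Local Notation rc j := (replace_coord Z Z' j).

(** This is the [G] of the analytic part: bounded and Hermitian at every point, of mean exactly
    zero, and almost surely equal to [X] along [Z]. *)
Definition recentered (z : E) : 'M[R[i]]_d :=
  truncated H K z - mean_mx mu (truncated H K).

Lemma recentered_herm z : recentered z \is hermsymmx.
Proof.
apply: hermsymmxB; first exact: truncated_herm.
by apply: mean_mx_herm => [|x]; [exact: mxbmeas_truncated|exact: truncated_herm].
Qed.

Lemma mxbmeas_recentered : mxbmeas recentered.
Proof. exact: (mxbmeasB (mxbmeas_truncated K mH) (mxbmeas_cst _)). Qed.

Lemma mean_recentered : mean_mx mu recentered = 0.
Proof.
apply/matrixP => i j; have [b1 b2] := mxbmeas_truncated K mH i j.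
rewrite !mxE; apply/eqP; rewrite eq_complex /=; apply/andP; split; apply/eqP.
  rewrite (@eq_mean _ _ _ mu _ (fun z => complex.Re (truncated H K z i j) -
    \int[mu]_t complex.Re (truncated H K t i j))); last by move=> z; rewrite !mxE raddfB.
  by rewrite (meanB mu b1 (bmeas_cst _)) mean_cst subrr.
rewrite (@eq_mean _ _ _ mu _ (fun z => complex.Im (truncated H K z i j) -
  \int[mu]_t complex.Im (truncated H K t i j))); last by move=> z; rewrite !mxE raddfB.
by rewrite (meanB mu b2 (bmeas_cst _)) mean_cst subrr.
Qed.

Lemma fine_expectation_ae (f : Omega -> R) (g : E -> R) : bmeas g ->
  {ae P, forall w, f w = g (Z w)} -> fine 'E_P[f] = \int[mu]_z g z.
Proof.
move=> bg fg; rewrite unlock -(mean_law P mZ bg) /Rintegral; congr fine.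
apply: integral_ae; last by apply: filterS fg => w ->.
by apply/measurable_EFinP; have [] := bmeas_comp mZ bg.
Qed.

Lemma expectation_mx_truncated :
  expectation_mx P (H \o Z) = mean_mx mu (truncated H K).
Proof.
apply/matrixP => i j; have [b1 b2] := mxbmeas_truncated K mH i j.
rewrite !mxE (fine_expectation_ae b1) ?(fine_expectation_ae b2)//.
  by apply: filterS tameZ => w wt; rewrite truncatedE.
by apply: filterS tameZ => w wt; rewrite truncatedE.
Qed.

Lemma centered_ae : {ae P, forall w, centered P Z H w = recentered (Z w)}.
Proof.
apply: filterS tameZ => w wt.
by rewrite /centered /recentered expectation_mx_truncated truncatedE.
Qed.

Lemma centered_copy_ae j :
  {ae P, forall w, centered_copy P Z Z' H j w = recentered (rc j w)}.
Proof.
have mt := measurableC (measurable_tame K mH).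
have mrc := measurable_replace_coord polishX mZ copiesZ j.
(* The copy has the law of [Z], so it too avoids the complement of [tame] almost surely. *)
have tamerc : {ae P, forall w, tame H K (rc j w)}.
  exists (rc j @^-1` (~` tame H K)); split => //.
    by rewrite -[X in measurable X]setTI; exact: mrc.
  apply: (etrans (replace_coord_law polishX mZ indepZ copiesZ j mt)).
  have mZt : measurable (Z @^-1` (~` tame H K)).
    by rewrite -[X in measurable X]setTI; exact: mZ.
  by apply/(negligibleP _ mZt); exact: tameZ.
apply: filterS tamerc => w wt.
by rewrite /centered_copy /recentered expectation_mx_truncated truncatedE.
Qed.

Let sqdiff (u : E * E) := (recentered u.1 - recentered u.2) *m (recentered u.1 - recentered u.2).

Let mxbmeas_sqdiff : mxbmeas sqdiff.
Proof.
have b1 : mxbmeas (fun u : E * E => recentered u.1).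
  move=> i j; have [c1 c2] := mxbmeas_recentered i j.
  by split; [exact: (bmeas_comp measurable_fst c1)|exact: (bmeas_comp measurable_fst c2)].
have b2 : mxbmeas (fun u : E * E => recentered u.2).
  move=> i j; have [c1 c2] := mxbmeas_recentered i j.
  by split; [exact: (bmeas_comp measurable_snd c1)|exact: (bmeas_comp measurable_snd c2)].
exact: (mxbmeasM (mxbmeasB b1 b2) (mxbmeasB b1 b2)).
Qed.

Let sqdiff_ae j : {ae P, forall w,
  (centered P Z H w - centered_copy P Z Z' H j w) ^+ 2 = sqdiff (Z w, rc j w)}.
Proof. by apply: filterS2 centered_ae (centered_copy_ae j) => w -> ->. Qed.

(** Freezing [Z] and integrating out the fresh coordinate gives a candidate for the conditional
    expectation. It is tested against indicators of events [Z^-1 B] with [mean_joint_law], and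
    uniqueness identifies it with [W]. *)
Lemma cond_expectation_scalar_ae j (Y W : Omega -> R) (g : E * E -> R) : bmeas g ->
  {ae P, forall w, Y w = g (Z w, rc j w)} ->
  is_cond_expectation P (g_sigma_algebra_preimage Z) Y W ->
  {ae P, forall w, W w = \int[mu]_y g (Z w, splice (~: [set j])%SET (Z w) y)}.
Proof.
move=> bg Yg WY.
have msp := measurable_fun_pair (@measurable_fst _ _ E E)
  (measurable_splice polishX (~: [set j])%SET).
have bD : bmeas (fun z => \int[mu]_y g (z, splice (~: [set j])%SET z y)).
  exact: (bmeas_mean mu (bmeas_comp msp bg)).
apply: (is_cond_expectation_ae mZ WY bD) => B mB.
have bB : bmeas (\1_B : E -> R).
  split; first exact: measurable_indic.
  by exists 1 => z; rewrite indicE; case: (z \in B); rewrite ?normr1 ?normr0.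
have mrc := measurable_fun_pair mZ (measurable_replace_coord polishX mZ copiesZ j).
have b1 : bmeas (fun u : E * E => (\1_B u.1 : R) * g u).
  exact: (bmeasM (bmeas_comp measurable_fst bB) bg).
have b2 := bmeasM bB bD.
transitivity (\int[P]_w ((\1_B (Z w) : R) * g (Z w, rc j w))%:E)%E.
  rewrite integral_mkcond; apply: integral_ae.
    by apply/measurable_EFinP; have [] := bmeas_comp mrc b1.
  apply: filterS Yg => w Yw; rewrite patchE indicE.
  have -> : (w \in Z @^-1` B) = (Z w \in B).
    by apply/idP/idP => /set_mem h; exact: mem_set.
  by case: (Z w \in B); rewrite ?mul1r ?mul0r// Yw.
transitivity (\int[P]_w ((\1_B (Z w) : R) *
    \int[mu]_y g (Z w, splice (~: [set j])%SET (Z w) y))%:E)%E; last first.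
  rewrite [RHS]integral_mkcond; apply: eq_integral => w _; rewrite patchE indicE.
  have -> : (w \in Z @^-1` B) = (Z w \in B).
    by apply/idP/idP => /set_mem h; exact: mem_set.
  by case: (Z w \in B); rewrite ?mul1r ?mul0r.
apply: (etrans (esym (EFin_mean P (bmeas_comp mrc b1)))).
apply: etrans (EFin_mean P (bmeas_comp mZ b2)); congr EFin.
apply: (etrans (mean_joint_law polishX mZ copiesZ j b1)).
apply: etrans (esym (mean_law P mZ b2)).
apply: eq_mean => z; rewrite -(meanZ mu)//.
exact: (bmeas_section z (bmeas_comp msp bg)).
Qed.

Lemma variance_proxy_ae V : is_variance_proxy P Z Z' H V ->
  {ae P, forall w, V w = proxy mu splice recentered (Z w)}.
Proof.
move=> [W [WY VW]].
have Wae : {ae P, forall w, forall j i k, W j w i k =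
    mean_mx mu (fun y => jump splice recentered j (Z w, y) *m
      jump splice recentered j (Z w, y)) i k}.
  apply: filter_forall => j; apply: filter_forall => i; apply: filter_forall => k.
  have [WR WI] := WY j i k; have [bR bI] := mxbmeas_sqdiff i k.
  have aR : {ae P, forall w, complex.Re (((centered P Z H w -
      centered_copy P Z Z' H j w) ^+ 2) i k) = complex.Re (sqdiff (Z w, rc j w) i k)}.
    by apply: filterS (sqdiff_ae j) => w ->.
  have aI : {ae P, forall w, complex.Im (((centered P Z H w -
      centered_copy P Z Z' H j w) ^+ 2) i k) = complex.Im (sqdiff (Z w, rc j w) i k)}.
    by apply: filterS (sqdiff_ae j) => w ->.
  apply: filterS2 (cond_expectation_scalar_ae bR aR WR)
    (cond_expectation_scalar_ae bI aI WI) => w wR wI.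
  rewrite mxE; apply/eqP; rewrite eq_complex /=; apply/andP; split; apply/eqP.
    exact: wR.
  exact: wI.
apply: filterS Wae => w wW; rewrite VW /proxy.
have -> : 2^-1 = (2^-1)%:C :> R[i] by rewrite fmorphV rmorph_nat.
congr (_ *: _); apply: eq_bigr => j _; apply/matrixP => i k; exact: wW.
Qed.

Lemma expectation_ntrace_expmx (t : R) (Y : Omega -> 'M[R[i]]_d) (F : E -> 'M[R[i]]_d) :
  (forall z, F z \is hermsymmx) -> mxbmeas F -> {ae P, forall w, Y w = F (Z w)} ->
  fine 'E_P[fun w => complex.Re (ntrace (expmx (t%:C *: Y w)))] =
  d%:R^-1 * \int[mu]_z rtr (expmx (t%:C *: F z)).
Proof.
move=> hF bF YF.
have be : bmeas (fun z => rtr (expmx (t%:C *: F z))).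
  exact: (bmeas_rtr (mxbmeas_expmx (fun z => hermsymmxZ t (hF z)) (mxbmeasZ _ bF))).
apply: (etrans (@fine_expectation_ae _
  (fun z => d%:R^-1 * rtr (expmx (t%:C *: F z))) (bmeasZ _ be) _)).
  by apply: filterS YF => w Yw; rewrite ntrace_Re Yw.
exact: (meanZ mu _ be).
Qed.

End reduction.

Theorem theorem4p3 (R : realType)
    (dO : measure_display) (Omega : measurableType dO)
    (P : probability Omega R) (n d : nat) (T : 'I_n -> ptopologicalType)
    (Z : Omega -> borelType (prod_topology T))
    (Z' : forall j : 'I_n, Omega -> borelType (T j))
    (H : borelType (prod_topology T) -> 'M[R[i]]_d)
    (V : Omega -> 'M[R[i]]_d) (psi theta : R)
    (d_gt0 : (0 < d)%N)
    (polishZ : polish R (prod_topology T))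
    (measurableZ : measurable_fun setT Z)
    (indepZ : mutually_independent P
                (fun (j : 'I_n) (w : Omega) => Z w j : borelType (T j)))
    (copiesZ : independent_copies P Z Z')
    (hermH : forall z, H z \is hermsymmx)
    (measurableH : measurable_mx H)
    (boundedX : exists M : R,
        {ae P, forall w, opnorm (centered P Z H w) <= M})
    (proxyV : is_variance_proxy P Z Z' H V)
    (psi_gt0 : 0 < psi)
    (theta_lt : `|theta| < Num.sqrt (psi / 2)) :
  ln (fine 'E_P[fun w =>
        complex.Re (ntrace (expmx (theta%:C *: centered P Z H w)))])
    <= (theta ^+ 2 / psi) / (1 - 2 * theta ^+ 2 / psi)
       * ln (fine 'E_P[fun w => complex.Re (ntrace (expmx (psi%:C *: V w)))]).
Proof.
case: boundedX => M bM.
(* From [frob H <= 2 (frob (H - E H) + frob (E H))] and the bound [d M^2] on the squared Frobenius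
   norm of [X]. *)
pose K := 2 * (d%:R * M ^+ 2 + frob (expectation_mx P (H \o Z))).
have tameZ : {ae P, forall w, tame H K (Z w)}.
  apply: filterS bM => w wM; apply: (le_trans (frobB_le _ (expectation_mx P (H \o Z)))).
  by rewrite /K ler_wpM2l// lerD2r; exact: frob_le_opnorm.
have mix := mixing_law polishZ measurableZ indepZ.
have hG := recentered_herm P K measurableZ hermH measurableH.
have bG := mxbmeas_recentered P K measurableZ measurableH.
have G0 := mean_recentered P K measurableZ measurableH.
have cE := centered_ae measurableZ measurableH tameZ.
have vE := variance_proxy_ae polishZ measurableZ indepZ copiesZ measurableH tameZ proxyV.
have E1 := expectation_ntrace_expmx measurableZ theta hG bG cE.
have E2 := expectation_ntrace_expmx measurableZ psi (proxy_herm mix hG bG) (mxbmeas_proxy mix bG) vE.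
have psi2 : 0 < psi / 2 by rewrite divr_gt0.
have small : 2 * theta ^+ 2 / psi < 1.
  rewrite ltr_pdivrMr// mul1r -ltr_pdivlMl// mulrC.
  rewrite -(real_normK (num_real theta)) -[ltRHS](sqr_sqrtr (ltW psi2)).
  by rewrite ltr_sqr// nnegrE sqrtr_ge0.
have transport (a a' b b' c : R) :
    a = a' -> b = b' -> ln a' <= c * ln b' -> ln a <= c * ln b by move=> -> ->.
exact: (transport _ _ _ _ _ E1 E2 (log_mgf_le mix psi_gt0 d_gt0 hG bG G0 small)).
Qed.
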